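(* Let $\mathbb F$ be a field of characteristic $p>0$. (1) Let $A$ be an augmented commutative $\mathbb F$-algebra, $\hat A$ the divided power algebra freely generated by $A$ (the PD envelope of the augmentation ideal of $A$), and $M$ a $V(\hat A)$-module. Then there is a comparison map $$\mathrm{HQ}^*_{p\text{-}\mathrm{Com}}(\hat A;M)\to\mathrm{HQ}^*_{\mathrm{Com}}(A;{}_AM),$$ where ${}_AM$ is $M$ with the $A$-module structure obtained by restriction of scalars along the unit $\eta_A:A\to\hat A$. (2) Let $B$ be a divided power algebra (an object of $p\text{-}\mathrm{Com}$) and $M$ a $V(B)$-module. Then there is a comparison map $$\mathrm{HQ}^*_{p\text{-}\mathrm{Com}}(B;M)\to\mathrm{HQ}^*_{\mathrm{Com}}(B;\theta^*M),$$ where $\theta:B\to V(B)$, $\theta(b)=b\otimes1$.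
   Context: $\mathrm{Com}_{\mathrm{aug}}$ is the category of augmented commutative $\mathbb F$-algebras $A=\mathbb F\oplus A_+$. $p\text{-}\mathrm{Com}$ is the category of pairs $(A,\pi)$, $A\in\mathrm{Com}_{\mathrm{aug}}$ and $\pi:A_+\to A_+$ a map with $a^p=0$, $\pi(a+b)=\pi(a)+\pi(b)+\sum_{k=1}^{p-1}\frac{(-1)^k}{k}a^kb^{p-k}$, $\pi(ab)=0$, $\pi(\lambda a)=\lambda^p\pi(a)$ for $a,b\in A_+$, $\lambda\in\mathbb F$; morphisms are augmented algebra maps commuting with $\pi$. This category is equivalent (Soublin) to that of divided power structures on augmentation ideals, $\pi$ playing the role of $\gamma_p$. The forgetful functor $U:p\text{-}\mathrm{Com}\to\mathrm{Com}_{\mathrm{aug}}$ has a left adjoint $A\mapsto\hat A$ (PD envelope of $A_+$), with unit $\eta_A:A\to\hat A$. For $A\in p\text{-}\mathrm{Com}$, $V(A)=A\otimes_{\mathbb F}R_f$, where $R_f$ is the ring of polynomials $\sum\lambda_if^i$ with $f\lambda=\lambda^pf$; $A$ and $R_f$ are subrings, $(a\otimes1)(1\otimes f)=a\otimes f$, and $(1\otimes f)(a\otimes1)=0$ for $a\in A_+$. A left $V(A)$-module is the same as an $A$-module $M$ with a $p$-semilinear map $\pi:M\to M$ such that $\pi(am)=0$ for $a\in A_+$; these are equivalent to Beck modules over $A$ in $p\text{-}\mathrm{Com}$ (abelian group objects in $p\text{-}\mathrm{Com}/A$), $(M,\pi)$ corresponding to the square-zero extension $A\oplus M$ with $\pi(a,m)=(\pi(a),\pi(m)-a^{p-1}m)$.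 Beck modules over $A$ in $\mathrm{Com}_{\mathrm{aug}}$ are $A$-modules. Thus $\theta^*$ forgets $\pi$. Quillen cohomology in a category $\mathcal C$ (here $p\text{-}\mathrm{Com}$, or $\mathrm{Com}_{\mathrm{aug}}$, indicated by the subscript $\mathrm{Com}$): $\mathrm{HQ}^n(X;M)=\pi^n\mathrm{Hom}(Ab_X(C_\bullet\to X),M)$ where $C_\bullet\xrightarrow{\sim}X$ is a cofibrant replacement in simplicial objects (standard Quillen model structure) and $Ab_X$ is left adjoint to the forgetful functor from Beck modules over $X$ to $\mathcal C/X$; equivalently $\pi^n$ of the Beck derivations $\mathrm{Hom}_{\mathcal C/X}(C_\bullet,E)$, $E\to X$ being the Beck module corresponding to $M$. Comparison maps. In (1): for cofibrant replacements $C_\bullet\to A$ in $s\mathrm{Com}_{\mathrm{aug}}$ and $D_\bullet\to\hat A$ in $s(p\text{-}\mathrm{Com})$, choose $\hat C_\bullet\to D_\bullet$ over $\hat A$; the comparison map is induced by $\mathrm{Hom}_{/\hat A}(D_\bullet,E)\to\mathrm{Hom}_{/\hat A}(\hat C_\bullet,E)\cong\mathrm{Hom}_{/A}(C_\bullet,\eta_A^*UE)$. In (2): for cofibrant replacements $D_\bullet\to B$ in $s(p\text{-}\mathrm{Com})$ and $C_\bullet\to UB$ in $s\mathrm{Com}_{\mathrm{aug}}$, choose $C_\bullet\to UD_\bullet$ over $UB$; the comparison map is induced by $\mathrm{Hom}_{/B}(D_\bullet,E)\to\mathrm{Hom}_{/UB}(UD_\bullet,UE)\to\mathrm{Hom}_{/UB}(C_\bullet,UE)$.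 *)

(* Defs.v *)
From HB Require Import structures.
From mathcomp Require Import all_boot all_order all_algebra boolp.
Set Implicit Arguments.
Unset Strict Implicit.
Unset Printing Implicit Defensive.
Import GRing.Theory.
Local Open Scope ring_scope.

(* Categories with a forgetful functor [und] to abelian groups, in terms of
   which fibrations and weak equivalences of simplicial objects are defined. *)
Record algCat := AlgCat {
  Ob :> Type;
  Mor : Ob -> Ob -> Type;
  idm : forall A, Mor A A;
  compm : forall A B C, Mor B C -> Mor A B -> Mor A C;
  und : Ob -> zmodType;
  undm : forall A B, Mor A B -> {additive und A -> und B};
  compmA : forall A B C D (h : Mor C D) (g : Mor B C) (f : Mor A B),
    compm h (compm g f) = compm (compm h g) f;
  comp1m : forall A B (f : Mor A B), compm (idm B) f = f;
  compm1 : forall A B (f : Mor A B), compm f (idm A) = f;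
  undm1 : forall A x, undm (idm A) x = x;
  undmM : forall A B C (g : Mor B C) (f : Mor A B) x,
    undm (compm g f) x = undm g (undm f x) }.

Arguments Mor {a}.
Arguments idm {a}.
Arguments compm {a A B C}.
Arguments und {a}.
Arguments undm {a A B}.

Notation "g \oc f" := (compm g f) (at level 50, left associativity).

Record functor (C D : algCat) := Functor {
  fob :> C -> D;
  fmor : forall A B, Mor A B -> Mor (fob A) (fob B);
  fmor1 : forall A, fmor (idm A) = idm (fob A);
  fmorM : forall X Y Z (g : Mor Y Z) (f : Mor X Y),
    fmor (g \oc f) = fmor g \oc fmor f }.

Arguments fmor {C D} _ {A B} _.

Record left_adjoint (C D : algCat) (U : functor D C) := LeftAdjoint {
  ladj :> functor C D;
  adj_unit : forall A : C, Mor A (U (ladj A));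
  adj_unit_nat : forall (A B : C) (f : Mor A B),
    adj_unit B \oc f = fmor U (fmor ladj f) \oc adj_unit A;
  adj_univ : forall (A : C) (B : D) (f : Mor A (U B)),
    exists! g : Mor (ladj A) B, fmor U g \oc adj_unit A = f }.

Arguments adj_unit {C D U} l A.

Record mono (m n : nat) := Mono {
  mfun :> 'I_m.+1 -> 'I_n.+1;
  mfun_le : forall i j : 'I_m.+1, (i <= j)%N -> (mfun i <= mfun j)%N }.

Lemma mono_eq m n (a b : mono m n) : a =1 b -> a = b.
Proof.
case: a b => [f lf] [g lg] /= /funext efg; subst g.
by congr Mono; apply: Prop_irrelevance.
Qed.

Definition mono_id n : mono n n := @Mono n n id (fun _ _ h => h).

Definition mono_comp m n q (b : mono n q) (a : mono m n) : mono m q :=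
  @Mono m q (fun i => b (a i)) (fun i j h => mfun_le b (mfun_le a h)).

Lemma lift_le n (i : 'I_n.+2) (j k : 'I_n.+1) :
  (j <= k)%N -> (lift i j <= lift i k)%N.
Proof. by rewrite /= leq_bump2. Qed.

Definition coface n (i : 'I_n.+2) : mono n n.+1 :=
  @Mono n n.+1 (lift i) (@lift_le n i).

Record sobj (K : algCat) := SObj {
  sob :> nat -> K;
  sact : forall m n, mono m n -> Mor (sob n) (sob m);
  sact1 : forall n, sact (mono_id n) = idm (sob n);
  sactM : forall m n q (b : mono n q) (a : mono m n),
    sact (mono_comp b a) = sact a \oc sact b }.

Arguments sact {K} s {m n}.

Record smap (K : algCat) (X Y : sobj K) := SMap {
  smapn :> forall n, Mor (X n) (Y n);
  smap_nat : forall m n (a : mono m n),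
    smapn m \oc sact X a = sact Y a \oc smapn n }.

Section Constructions.
Variable K : algCat.

Lemma scomp_nat (X Y Z : sobj K) (g : smap Y Z) (f : smap X Y) m n
    (a : mono m n) :
  (g m \oc f m) \oc sact X a = sact Z a \oc (g n \oc f n).
Proof. by rewrite -compmA smap_nat compmA smap_nat compmA. Qed.

Definition scomp (X Y Z : sobj K) (g : smap Y Z) (f : smap X Y) : smap X Z :=
  @SMap K X Z (fun n => g n \oc f n) (scomp_nat g f).

Definition sconst (X : K) : sobj K :=
  @SObj K (fun=> X) (fun _ _ _ => idm X) (fun=> erefl)
    (fun _ _ _ _ _ => esym (comp1m (idm X))).

(* simplicial objects of the slice category K/X *)
Record sover (X : K) := SOver {
  sov :> sobj K;
  sproj : forall n, Mor (sov n) X;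
  sproj_nat : forall m n (a : mono m n), sproj m \oc sact sov a = sproj n }.

Record overMap (X : K) (C D : sover X) := OverMap {
  om :> smap C D;
  om_over : forall n, sproj D n \oc om n = sproj C n }.

Lemma saug_nat (X : K) (C : sover X) m n (a : mono m n) :
  sproj C m \oc sact C a = sact (sconst X) a \oc sproj C n.
Proof. by rewrite sproj_nat comp1m. Qed.

Definition saug (X : K) (C : sover X) : smap C (sconst X) :=
  @SMap K C (sconst X) (sproj C) (@saug_nat X C).

Definition face (X : sobj K) n (i : 'I_n.+2) (x : und (X n.+1)) : und (X n) :=
  undm (sact X (coface i)) x.

(* A horn in [Y] is given by its faces [y i], [i != k]; they define a
   simplicial map on the union of these faces of the standard simplex when any
   two of them agree on every common simplex. *)
Definition kan_fibration (Y Z : sobj K) (f : smap Y Z) : Prop :=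
  forall n (k : 'I_n.+2) (y : 'I_n.+2 -> und (Y n)) (z : und (Z n.+1)),
    (forall i j, i != k -> j != k ->
       forall q (a b : mono q n),
         mono_comp (coface i) a = mono_comp (coface j) b ->
         undm (sact Y a) (y i) = undm (sact Y b) (y j)) ->
    (forall i, i != k -> face i z = undm (f n) (y i)) ->
    exists x : und (Y n.+1),
      (forall i, i != k -> face i x = y i) /\ undm (f n.+1) x = z.

(* The homotopy group [pi_n X] of the simplicial group [X] is
   [scycle X n / sbound X n]. *)
Definition scycle (X : sobj K) n : und (X n) -> Prop :=
  match n with
  | 0 => fun=> True
  | m.+1 => fun x : und (X m.+1) => forall i : 'I_m.+2, face i x = 0
  end.

Definition sbound (X : sobj K) n (x : und (X n)) : Prop :=
  exists z : und (X n.+1),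
    (forall i : 'I_n.+2, i != ord0 -> face i z = 0) /\ face ord0 z = x.

Definition weak_equivalence (X Y : sobj K) (f : smap X Y) : Prop :=
  forall n,
    (forall x : und (X n), scycle x -> sbound (undm (f n) x) -> sbound x) /\
    (forall y : und (Y n), scycle y ->
       exists2 x : und (X n), scycle x & sbound (y - undm (f n) x)).

Definition trivial_fibration (Y Z : sobj K) (f : smap Y Z) : Prop :=
  kan_fibration f /\ weak_equivalence f.

(* The map from the initial object has the left lifting property against
   trivial fibrations; the square then commutes automatically. *)
Definition cofibrant (C : sobj K) : Prop :=
  forall (Y Z : sobj K) (q : smap Y Z), trivial_fibration q ->
  forall g : smap C Z, exists h : smap C Y, scomp q h = g.

Record cofrep (X : K) := CofRep {
  cofr :> sover X;
  cofr_cofibrant : cofibrant cofr;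
  cofr_weq : weak_equivalence (saug cofr) }.

End Constructions.

Arguments sproj {K X} s n.

Section FunctorSimplicial.
Variables (K K' : algCat) (T : functor K K') (X : K) (C : sover X).

Lemma sfun1 n : fmor T (sact C (mono_id n)) = idm (T (C n)).
Proof. by rewrite sact1 fmor1. Qed.

Lemma sfunM m n q (b : mono n q) (a : mono m n) :
  fmor T (sact C (mono_comp b a)) =
  fmor T (sact C a) \oc fmor T (sact C b).
Proof. by rewrite sactM fmorM. Qed.

Definition sfun_obj : sobj K' :=
  @SObj K' (fun n => T (C n)) (fun m n a => fmor T (sact C a)) sfun1 sfunM.

Lemma sfun_nat m n (a : mono m n) :
  fmor T (sproj C m) \oc sact sfun_obj a = fmor T (sproj C n).
Proof. by rewrite -(sproj_nat C a) fmorM. Qed.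

Definition sfun : sover (T X) :=
  @SOver K' (T X) sfun_obj (fun n => fmor T (sproj C n)) sfun_nat.

End FunctorSimplicial.

Record cosimp := Cosimp {
  cos :> nat -> zmodType;
  cact : forall m n, mono m n -> {additive cos m -> cos n};
  cact1 : forall n x, cact (mono_id n) x = x;
  cactM : forall m n q (b : mono n q) (a : mono m n) x,
    cact (mono_comp b a) x = cact b (cact a x) }.

Arguments cact c {m n}.

Record cmap (G H : cosimp) := CMap {
  cmapn :> forall n, {additive G n -> H n};
  cmap_nat : forall m n (a : mono m n) x,
    cmapn n (cact G a x) = cact H a (cmapn m x) }.

Lemma ccomp_nat (G H J : cosimp) (g : cmap H J) (f : cmap G H) m n
    (a : mono m n) x :
  (g n \o f n) (cact G a x) = cact J a ((g m \o f m) x).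
Proof. by rewrite /= !cmap_nat. Qed.

Definition ccomp (G H J : cosimp) (g : cmap H J) (f : cmap G H) : cmap G J :=
  @CMap G J (fun n => g n \o f n) (@ccomp_nat G H J g f).

Section Cohomotopy.
Variable G : cosimp.

Definition cdiff n (x : G n) : G n.+1 :=
  \sum_(i < n.+2) cact G (coface i) x *~ ((-1) ^+ i).

Lemma cdiff_is_zmod_morphism n : zmod_morphism (@cdiff n).
Proof.
move=> x y; rewrite /cdiff -sumrB; apply: eq_bigr => i _.
by rewrite raddfB mulrzBl.
Qed.

HB.instance Definition _ n :=
  GRing.isZmodMorphism.Build (G n) (G n.+1) (@cdiff n)
    (@cdiff_is_zmod_morphism n).

Definition is_cocycle n : {pred G n} := [pred x | cdiff x == 0].

Lemma is_cocycle_zmod n : zmod_closed (@is_cocycle n).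
Proof.
split=> [|x y]; first by rewrite inE raddf0.
by rewrite !inE => /eqP hx /eqP hy; rewrite raddfB /= hx hy subrr.
Qed.

HB.instance Definition _ n :=
  GRing.isZmodClosed.Build (G n) (@is_cocycle n) (@is_cocycle_zmod n).

Record cocycle n := Cocycle { cocval :> G n; _ : cocval \in @is_cocycle n }.

HB.instance Definition _ n := [isSub for @cocval n].
HB.instance Definition _ n := [Choice of cocycle n by <:].
HB.instance Definition _ n := [SubChoice_isSubZmodule of cocycle n by <:].

Definition coboundary n : G n -> Prop :=
  match n with
  | 0 => fun x => x = 0
  | m.+1 => fun x => exists y : G m, cdiff y = x
  end.

Lemma coboundary_sub n (x y : G n) :
  coboundary x -> coboundary y -> coboundary (x - y).
Proof.
case: n x y => [|n] x y /= hx hy; first by rewrite hx hy subrr.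
by case: hx hy => a <- [b <-]; exists (a - b); rewrite raddfB.
Qed.

Definition is_coboundary n : {pred cocycle n} :=
  [pred x | `[< coboundary (\val x) >]].

Lemma is_coboundary_zmod n : zmod_closed (@is_coboundary n).
Proof.
split=> [|x y]; rewrite !inE.
  apply/asboolP; rewrite (raddf0 \val).
  by case: n => [//|n]; exists 0; rewrite raddf0.
move=> /asboolP hx /asboolP hy; apply/asboolP.
by rewrite (raddfB \val); apply: coboundary_sub.
Qed.

HB.instance Definition _ n :=
  GRing.isZmodClosed.Build (cocycle n) (@is_coboundary n)
    (@is_coboundary_zmod n).

(* [pi^n G], the n-th cohomology of the associated cochain complex *)
Definition cohomotopy n : zmodType := Quotient.quot (@is_coboundary n).

End Cohomotopy.

Section CohomotopyMap.
Variables (G H : cosimp) (f : cmap G H).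

Lemma cdiff_nat n (x : G n) : cdiff (f n x) = f n.+1 (cdiff x).
Proof.
rewrite /cdiff raddf_sum; apply: eq_bigr => i _.
by rewrite raddfMz cmap_nat.
Qed.

Lemma cocyc_subproof n (x : cocycle G n) : f n (\val x) \in @is_cocycle H n.
Proof.
case: x => x /=; rewrite !inE => /eqP hx.
by rewrite cdiff_nat hx raddf0.
Qed.

Definition cocyc_map n (x : cocycle G n) : cocycle H n :=
  Cocycle (cocyc_subproof x).

Lemma coboundary_map n (x : G n) : coboundary x -> coboundary (f n x).
Proof.
case: n x => [|n] x /=; first by move->; rewrite raddf0.
by case=> y <-; exists (f n y); rewrite cdiff_nat.
Qed.

Definition cohomotopy_fun n (x : cohomotopy G n) : cohomotopy H n :=
  \pi_(cohomotopy H n)%qT (cocyc_map (repr x)).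

Lemma cohomotopy_funE n (z : cocycle G n) :
  cohomotopy_fun (\pi_(cohomotopy G n)%qT z) =
  \pi_(cohomotopy H n)%qT (cocyc_map z).
Proof.
rewrite /cohomotopy_fun; apply/eqP; rewrite -Quotient.idealrBE inE.
apply/asboolP; rewrite raddfB /= -raddfB.
apply: coboundary_map.
have : repr (\pi_(cohomotopy G n)%qT z) - z \in is_coboundary (n := n).
  by rewrite Quotient.idealrBE reprK.
by rewrite inE => /asboolP; rewrite raddfB.
Qed.

Lemma cohomotopy_fun_zmod n : zmod_morphism (@cohomotopy_fun n).
Proof.
move=> x y; rewrite -[x]reprK -[y]reprK -raddfB !cohomotopy_funE -raddfB.
by congr (\pi_(cohomotopy H n)%qT _); apply: val_inj; rewrite /= !raddfB.
Qed.

HB.instance Definition _ n :=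
  GRing.isZmodMorphism.Build (cohomotopy G n) (cohomotopy H n)
    (@cohomotopy_fun n) (@cohomotopy_fun_zmod n).

Definition cohomotopy_map n : {additive cohomotopy G n -> cohomotopy H n} :=
  @cohomotopy_fun n.

End CohomotopyMap.

Definition sliceHom (K : algCat) (X E T : K) (p : Mor E X) (t : Mor T X) :
  Type := {s : Mor T E | p \oc s = t}.

Lemma slice_eq (K : algCat) (X E T : K) (p : Mor E X) (t : Mor T X)
    (r s : sliceHom p t) :
  sval r = sval s -> r = s.
Proof.
case: r s => r hr [s hs] /= e; subst s.
by congr exist; apply: Prop_irrelevance.
Qed.

Section Pull.
Variables (K : algCat) (X E : K) (p : Mor E X) (S T : K).
Variables (t : Mor T X) (s : Mor S X) (u : Mor S T) (tu : t \oc u = s).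

Lemma pull_over (r : sliceHom p t) : p \oc (sval r \oc u) = s.
Proof. by rewrite compmA (svalP r). Qed.

Definition pull (r : sliceHom p t) : sliceHom p s :=
  exist _ (sval r \oc u) (pull_over r).

End Pull.

Arguments pull {K X E p S T t s} u tu r.

(* An abelian group object of K/X: an object [beckp] of K/X together with an
   abelian group structure, natural in T, on the maps from T to it. *)
Record beck (K : algCat) (X : K) := Beck {
  beckE : K;
  beckp : Mor beckE X;
  beck0 : forall T (t : Mor T X), sliceHom beckp t;
  beckN : forall T (t : Mor T X), sliceHom beckp t -> sliceHom beckp t;
  beckD : forall T (t : Mor T X),
    sliceHom beckp t -> sliceHom beckp t -> sliceHom beckp t;
  beckDA : forall T (t : Mor T X), associative (@beckD T t);
  beckDC : forall T (t : Mor T X), commutative (@beckD T t);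
  beck0D : forall T (t : Mor T X), left_id (beck0 t) (@beckD T t);
  beckND : forall T (t : Mor T X),
    left_inverse (beck0 t) (@beckN T t) (@beckD T t);
  beck_nat : forall S T (t : Mor T X) (s : Mor S X) (u : Mor S T)
      (tu : t \oc u = s) (a b : sliceHom beckp t),
    pull u tu (beckD a b) = beckD (pull u tu a) (pull u tu b) }.

Definition beckHom (K : algCat) (X : K) (E : beck X) (T : K) (t : Mor T X) :
  Type := sliceHom (beckp E) t.

HB.instance Definition _ (K : algCat) (X : K) (E : beck X) (T : K)
  (t : Mor T X) := gen_eqMixin (beckHom E t).
HB.instance Definition _ (K : algCat) (X : K) (E : beck X) (T : K)
  (t : Mor T X) := gen_choiceMixin (beckHom E t).
HB.instance Definition _ (K : algCat) (X : K) (E : beck X) (T : K)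
  (t : Mor T X) :=
  GRing.isZmodule.Build (beckHom E t) (@beckDA _ _ E T t) (@beckDC _ _ E T t)
    (@beck0D _ _ E T t) (@beckND _ _ E T t).

Section Derivations.
Variables (K : algCat) (X : K) (E : beck X).

Section PullAdditive.
Variables (S T : K) (t : Mor T X) (s : Mor S X) (u : Mor S T).
Hypothesis tu : t \oc u = s.

Definition bpull (r : beckHom E t) : beckHom E s := pull u tu r.

Lemma bpullD a b : bpull (a + b) = bpull a + bpull b.
Proof. exact: beck_nat. Qed.

Lemma bpull_zmod : zmod_morphism bpull.
Proof.
move=> a b; apply: (addIr (bpull b)).
by rewrite -bpullD !subrK.
Qed.

HB.instance Definition _ :=
  GRing.isZmodMorphism.Build (beckHom E t) (beckHom E s) bpull bpull_zmod.

End PullAdditive.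

Section Der.
Variable C : sover X.

Definition der_act m n (a : mono m n) :
    {additive beckHom E (sproj C m) -> beckHom E (sproj C n)} :=
  bpull (sproj_nat C a).

Lemma der_act1 n x : der_act (mono_id n) x = x.
Proof. by apply: slice_eq; rewrite /= sact1 compm1. Qed.

Lemma der_actM m n q (b : mono n q) (a : mono m n) x :
  der_act (mono_comp b a) x = der_act b (der_act a x).
Proof. by apply: slice_eq; rewrite /= sactM compmA. Qed.

(* the cosimplicial abelian group [Hom_{K/X}(C, E)] of Beck derivations *)
Definition der : cosimp := @Cosimp _ der_act der_act1 der_actM.

End Der.

Section DerMap.
Variables (C D : sover X) (f : overMap C D).

Lemma der_pre_nat m n (a : mono m n) (x : der D m) :
  bpull (om_over f n) (cact (der D) a x) =
  cact (der C) a (bpull (om_over f m) x).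
Proof. by apply: slice_eq; rewrite /= -!compmA smap_nat. Qed.

Definition der_pre : cmap (der D) (der C) :=
  @CMap (der D) (der C) (fun n => bpull (om_over f n)) der_pre_nat.

End DerMap.

Definition HQ (C : cofrep X) (n : nat) : zmodType := cohomotopy (der C) n.

End Derivations.

Arguments der {K X} E C.
Arguments der_pre {K X} E {C D} f.
Arguments HQ {K X} E C n.

Definition HQ_map (K : algCat) (X : K) (E : beck X) (C D : cofrep X)
    (f : overMap C D) (n : nat) : {additive HQ E D n -> HQ E C n} :=
  cohomotopy_map (der_pre E f) n.

Section Algebras.
Variable F : fieldType.

Record augAlg := AugAlg {
  aalg :> comAlgType F;
  aug : {lrmorphism aalg -> F | *%R} }.

Record augHom (A B : augAlg) := AugHom {
  ahom :> A -> B;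
  ahom_lin : linear ahom;
  ahom_mul : monoid_morphism ahom;
  ahom_aug : forall a, aug B (ahom a) = aug A a }.

HB.instance Definition _ (A B : augAlg) (f : augHom A B) :=
  GRing.isLinear.Build F A B *:%R (ahom f) (ahom_lin f).
HB.instance Definition _ (A B : augAlg) (f : augHom A B) :=
  GRing.isMonoidMorphism.Build A B (ahom f) (ahom_mul f).

Lemma augHom_eq (A B : augAlg) (f g : augHom A B) : f =1 g -> f = g.
Proof.
case: f g => f f1 f2 f3 [g g1 g2 g3] /= /funext efg; subst g.
by congr AugHom; apply: Prop_irrelevance.
Qed.

Definition aug_id (A : augAlg) : augHom A A :=
  @AugHom A A id (fun _ _ _ => erefl) (conj erefl (fun _ _ => erefl))
    (fun _ => erefl).

Section AugComp.
Variables (A B C : augAlg) (g : augHom B C) (f : augHom A B).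

Lemma aug_comp_lin : linear (g \o f).
Proof. by move=> k a b; rewrite linearP. Qed.

Lemma aug_comp_mul : monoid_morphism (g \o f).
Proof. by split=> [|a b] /=; rewrite ?rmorph1 ?rmorphM. Qed.

Lemma aug_comp_aug a : aug C ((g \o f) a) = aug A a.
Proof. by rewrite /= !ahom_aug. Qed.

Definition aug_comp : augHom A C :=
  AugHom aug_comp_lin aug_comp_mul aug_comp_aug.

End AugComp.

Lemma aug_compA (A B C D : augAlg) (h : augHom C D) (g : augHom B C) (f : augHom A B) :
  aug_comp h (aug_comp g f) = aug_comp (aug_comp h g) f.
Proof. exact: augHom_eq. Qed.

Lemma aug_comp1m (A B : augAlg) (f : augHom A B) : aug_comp (aug_id B) f = f.
Proof. exact: augHom_eq. Qed.

Lemma aug_compm1 (A B : augAlg) (f : augHom A B) : aug_comp f (aug_id A) = f.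
Proof. exact: augHom_eq. Qed.

Definition ComAug : algCat :=
  @AlgCat augAlg augHom aug_id aug_comp (fun A => A)
    (fun A B f => f)
    aug_compA aug_comp1m aug_compm1
    (fun _ _ => erefl) (fun _ _ _ _ _ _ => erefl).

Variable p : nat.
Hypothesis charF : p \in [pchar F].

(* [ppi] is a map on the augmentation ideal [A_+ = ker aug]: its values
   elsewhere are unconstrained, and are ignored by morphisms. *)
Record pCom := PComPack {
  palg :> augAlg;
  ppi : palg -> palg;
  ppi_aug : forall a, aug palg a = 0 -> aug palg (ppi a) = 0;
  pexp0 : forall a, aug palg a = 0 -> a ^+ p = 0;
  ppiD : forall a b, aug palg a = 0 -> aug palg b = 0 ->
    ppi (a + b) = ppi a + ppi b +
      \sum_(1 <= k < p) ((-1) ^+ k / k%:R : F) *: (a ^+ k * b ^+ (p - k));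
  ppiM : forall a b, aug palg a = 0 -> aug palg b = 0 -> ppi (a * b) = 0;
  ppiZ : forall (c : F) a, aug palg a = 0 -> ppi (c *: a) = c ^+ p *: ppi a }.

Record pHom (A B : pCom) := PHom {
  phom :> augHom A B;
  phom_pi : forall a, aug A a = 0 -> phom (ppi a) = ppi (phom a) }.

Lemma pHom_eq (A B : pCom) (f g : pHom A B) : f =1 g -> f = g.
Proof.
case: f g => f f1 [g g1] /= /augHom_eq efg; subst g.
by congr PHom; apply: Prop_irrelevance.
Qed.

Definition p_id (A : pCom) : pHom A A := @PHom A A (aug_id A) (fun _ _ => erefl).

Lemma p_comp_pi (A B C : pCom) (g : pHom B C) (f : pHom A B) a :
  aug A a = 0 -> aug_comp g f (ppi a) = ppi (aug_comp g f a).
Proof. by move=> ha; rewrite /= phom_pi // phom_pi // ahom_aug. Qed.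

Definition p_comp (A B C : pCom) (g : pHom B C) (f : pHom A B) : pHom A C :=
  @PHom A C (aug_comp g f) (p_comp_pi g f).

Lemma p_compA (A B C D : pCom) (h : pHom C D) (g : pHom B C) (f : pHom A B) :
  p_comp h (p_comp g f) = p_comp (p_comp h g) f.
Proof. exact: pHom_eq. Qed.

Lemma p_comp1m (A B : pCom) (f : pHom A B) : p_comp (p_id B) f = f.
Proof. exact: pHom_eq. Qed.

Lemma p_compm1 (A B : pCom) (f : pHom A B) : p_comp f (p_id A) = f.
Proof. exact: pHom_eq. Qed.

Definition PCom : algCat :=
  @AlgCat pCom pHom p_id p_comp (fun A => A)
    (fun A B f => f)
    p_compA p_comp1m p_compm1
    (fun _ _ => erefl) (fun _ _ _ _ _ _ => erefl).

Definition forget : functor PCom ComAug :=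
  @Functor PCom ComAug (fun A : pCom => palg A) (fun A B (f : pHom A B) => phom f)
    (fun=> erefl) (fun _ _ _ _ _ => erefl).

End Algebras.

Section VRing.
Variables (F : fieldType) (p : nat).
Hypothesis charF : p \in [pchar F].
Variable A : augAlg F.

(* [V(A)] is free over [A] on the powers of [f], with [f a = (aug a)^p f] for
   [a] in [A]: this covers [f c = c^p f] for [c] in [F] and [f a = 0] for [a]
   in [A_+]. It is thus a twisted polynomial ring: the polynomial with
   coefficients [a_i] stands for the sum of the [a_i (x) f^i]. *)
Definition vring (_ : p \in [pchar F]) : Type := {poly A}.
Local Notation V := (vring charF).

HB.instance Definition _ := GRing.Zmodule.copy V {poly A}.

Definition vtwist (a : A) : A := (aug A a ^+ p)%:A.

Lemma expD_char (x y : F) : (x + y) ^+ p = x ^+ p + y ^+ p.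
Proof. exact: (rmorphD (pFrobenius_aut charF)). Qed.

Lemma exp0_char : 0 ^+ p = 0 :> F.
Proof. exact: (rmorph0 (pFrobenius_aut charF)). Qed.

Lemma vtwist_nmod : nmod_morphism vtwist.
Proof.
split=> [|a b]; rewrite /vtwist; first by rewrite rmorph0 exp0_char scale0r.
by rewrite rmorphD expD_char scalerDl.
Qed.

Lemma vtwist_mul : monoid_morphism vtwist.
Proof.
split=> [|a b]; rewrite /vtwist; first by rewrite rmorph1 expr1n scale1r.
by rewrite rmorphM exprMn -scalerAl mul1r scalerA.
Qed.

Lemma itwist_nmod i : nmod_morphism (iter i vtwist).
Proof.
elim: i => [//|i [h0 hD]]; split=> [|a b] /=; first by rewrite h0 vtwist_nmod.1.
by rewrite hD vtwist_nmod.2.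
Qed.

Lemma itwist_mul i : monoid_morphism (iter i vtwist).
Proof.
elim: i => [//|i [h1 hM]]; split=> [|a b] /=; first by rewrite h1 vtwist_mul.1.
by rewrite hM vtwist_mul.2.
Qed.

HB.instance Definition _ i :=
  GRing.isNmodMorphism.Build A A (iter i vtwist) (itwist_nmod i).
HB.instance Definition _ i :=
  GRing.isMonoidMorphism.Build A A (iter i vtwist) (itwist_mul i).

Definition vmul (P Q : {poly A}) : {poly A} :=
  \poly_(k < size P + size Q) \sum_(i < k.+1) P`_i * iter i vtwist Q`_(k - i).

Lemma coef_vmul P Q k :
  (vmul P Q)`_k = \sum_(i < k.+1) P`_i * iter i vtwist Q`_(k - i).
Proof.
rewrite coef_poly; case: ltnP => // hk; rewrite big1 // => i _.
have [hi|hi] := leqP (size P) i; first by rewrite nth_default ?mul0r.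
rewrite [Q`__]nth_default ?rmorph0 ?mulr0 //.
rewrite leq_subRL; first by rewrite (leq_trans _ hk) // leq_add2r ltnW.
by rewrite -ltnS.
Qed.

Lemma coef_vmul_rev P Q k :
  (vmul P Q)`_k = \sum_(i < k.+1) P`_(k - i) * iter (k - i) vtwist Q`_i.
Proof.
rewrite coef_vmul (reindex_inj rev_ord_inj) /=.
by apply: eq_bigr => i _; rewrite (sub_ordK i).
Qed.

Lemma vmulA : associative vmul.
Proof.
move=> P Q R; apply/polyP=> k; rewrite coef_vmul coef_vmul_rev.
pose g j i := P`_j * (iter j vtwist Q`_(k - j - i) * iter (k - i) vtwist R`_i).
transitivity (\sum_(j < k.+1) \sum_(i < k.+1 | (i <= k - j)%N) g j i).
  apply: eq_bigr => j _; rewrite coef_vmul_rev rmorph_sum big_distrr /=.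
  rewrite (big_ord_narrow_leq (leq_subr _ _)); apply: eq_bigr => i _.
  rewrite /g rmorphM /= -iterD subnAC subnKC //.
  have hi : (i <= k - j)%N by rewrite -ltnS.
  have hj : (j <= k)%N by rewrite -ltnS.
  rewrite leq_subRL; last exact: leq_trans hi (leq_subr _ _).
  by rewrite addnC -leq_subRL.
rewrite (exchange_big_dep predT) //=; apply: eq_bigr => i _.
transitivity (\sum_(j < k.+1 | (j <= k - i)%N) g j i).
  apply: eq_bigl => j; rewrite -ltnS -(ltnS j) -!subSn ?leq_ord //.
  by rewrite -subn_gt0 -(subn_gt0 j) -!subnDA addnC.
rewrite (big_ord_narrow_leq (leq_subr _ _)) coef_vmul big_distrl /=.
by apply: eq_bigr => j _; rewrite /g /= subnAC !mulrA.
Qed.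

Lemma vmul1 : left_id (1 : {poly A}) vmul.
Proof.
move=> P; apply/polyP=> k; rewrite coef_vmul big_ord_recl coef1 subn0 mul1r.
by rewrite big1 ?addr0 // => i _; rewrite coef1 mul0r.
Qed.

Lemma vmulr1 : right_id (1 : {poly A}) vmul.
Proof.
move=> P; apply/polyP=> k; rewrite coef_vmul_rev big_ord_recl coef1 subn0.
rewrite rmorph1 mulr1.
by rewrite big1 ?addr0 // => i _; rewrite coef1 rmorph0 mulr0.
Qed.

Lemma vmulDl : left_distributive vmul +%R.
Proof.
move=> P Q R; apply/polyP=> k; rewrite coefD !coef_vmul -big_split /=.
by apply: eq_bigr => i _; rewrite coefD mulrDl.
Qed.

Lemma vmulDr : right_distributive vmul +%R.
Proof.
move=> P Q R; apply/polyP=> k; rewrite coefD !coef_vmul -big_split /=.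
by apply: eq_bigr => i _; rewrite coefD rmorphD mulrDr.
Qed.

HB.instance Definition _ := GRing.Zmodule_isNzRing.Build V
  vmulA vmul1 vmulr1 vmulDl vmulDr (oner_neq0 {poly A}).

(* [b |-> b (x) 1] *)
Definition vtheta (b : A) : V := b%:P.

(* [1 (x) f] *)
Definition vf : V := 'X.

Lemma vtheta_nmod : nmod_morphism vtheta.
Proof. by split=> [|a b]; rewrite /vtheta ?polyC0 ?polyCD. Qed.

Lemma vtheta_mul : monoid_morphism vtheta.
Proof.
split=> [//|a b]; apply/polyP=> k; rewrite coef_vmul_rev coefC.
case: k => [|k]; first by rewrite big_ord1 !coefC.
rewrite big_ord_recl coefC subn0 mul0r big1 ?addr0 // => i _.
by rewrite !coefC /= rmorph0 mulr0.
Qed.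

HB.instance Definition _ :=
  GRing.isNmodMorphism.Build A V vtheta vtheta_nmod.
HB.instance Definition _ :=
  GRing.isMonoidMorphism.Build A V vtheta vtheta_mul.

Lemma vf_theta a : vf * vtheta a = vtheta (vtwist a) * vf.
Proof.
apply/polyP=> k; rewrite !coef_vmul /vf /vtheta; case: k => [|k].
  by rewrite !big_ord1 !coefX mul0r rmorph0 mulr0.
rewrite big_ord_recl coefX mul0r add0r big_ord_recl coefX mul1r.
rewrite big1 ?addr0; last by move=> i _; rewrite coefX mul0r.
rewrite [RHS]big_ord_recl big1 ?addr0; last first.
  by move=> i _; rewrite coefC mul0r.
rewrite !coefC coefX subn0 eqSS subSS subn0 /=.
by case: k => [|k] /=; rewrite ?mulr1 ?mulr0 ?vtwist_nmod.1.
Qed.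

End VRing.

Section Restriction.
Variables (R S : nzRingType) (h : {rmorphism R -> S}) (M : lmodType S).

Definition restr (_ : {rmorphism R -> S}) : Type := M.
Local Notation rM := (restr h).

HB.instance Definition _ := GRing.Zmodule.copy rM M.

Definition restr_scale (a : R) (m : rM) : rM := h a *: (m : M).

Lemma restr_scaleA a b m :
  restr_scale a (restr_scale b m) = restr_scale (a * b) m.
Proof. by rewrite /restr_scale rmorphM scalerA. Qed.

Lemma restr_scale1 : left_id 1 restr_scale.
Proof. by move=> m; rewrite /restr_scale rmorph1 scale1r. Qed.

Lemma restr_scaleDr : right_distributive restr_scale +%R.
Proof. by move=> a m n; rewrite /restr_scale scalerDr. Qed.

Lemma restr_scaleDl m : {morph restr_scale^~ m : a b / a + b}.
Proof. by move=> a b; rewrite /restr_scale rmorphD scalerDl. Qed.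

HB.instance Definition _ := GRing.Zmodule_isLmodule.Build R rM
  restr_scaleA restr_scale1 restr_scaleDr restr_scaleDl.

End Restriction.

Section SquareZero.
Variables (F : fieldType) (A : augAlg F) (N : lmodType A).

Definition sqz : Type := (A * N)%type.

HB.instance Definition _ := GRing.Zmodule.copy sqz (A * N)%type.

Definition sqz1 : sqz := (1, 0).
Definition sqz_mul (x y : sqz) : sqz := (x.1 * y.1, x.1 *: y.2 + y.1 *: x.2).
Definition sqz_scale (c : F) (x : sqz) : sqz := (c *: x.1, c%:A *: x.2).

Lemma sqz_mulA : associative sqz_mul.
Proof.
move=> [a m] [b n] [c q]; congr pair; rewrite /= ?mulrA //.
by rewrite !scalerDr !scalerA addrA [c * a]mulrC [c * b]mulrC.
Qed.

Lemma sqz_mulC : commutative sqz_mul.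
Proof. by move=> [a m] [b n]; congr pair; rewrite /= ?[a * b]mulrC // addrC. Qed.

Lemma sqz_mul1 : left_id sqz1 sqz_mul.
Proof. by move=> [a m]; congr pair; rewrite /= ?mul1r // scale1r scaler0 addr0. Qed.

Lemma sqz_mulD : left_distributive sqz_mul +%R.
Proof.
move=> [a m] [b n] [c q]; congr pair; rewrite /= ?mulrDl //.
by rewrite scalerDl scalerDr addrACA.
Qed.

Lemma sqz1_neq0 : sqz1 != 0.
Proof. by apply/eqP => -[] /eqP; rewrite oner_eq0. Qed.

HB.instance Definition _ := GRing.Zmodule_isComNzRing.Build sqz
  sqz_mulA sqz_mulC sqz_mul1 sqz_mulD sqz1_neq0.

Lemma sqz_scaleA a b x : sqz_scale a (sqz_scale b x) = sqz_scale (a * b) x.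
Proof.
by congr pair; rewrite /= ?scalerA // -scalerAl mul1r scalerA.
Qed.

Lemma sqz_scale1 : left_id 1 sqz_scale.
Proof. by move=> [a m]; congr pair; rewrite /= ?scale1r // scale1r. Qed.

Lemma sqz_scaleDr : right_distributive sqz_scale +%R.
Proof. by move=> c [a m] [b n]; congr pair; rewrite /= scalerDr. Qed.

Lemma sqz_scaleDl x : {morph sqz_scale^~ x : a b / a + b}.
Proof. by move=> a b; congr pair; rewrite /= ?scalerDl // scalerDl. Qed.

HB.instance Definition _ := GRing.Zmodule_isLmodule.Build F sqz
  sqz_scaleA sqz_scale1 sqz_scaleDr sqz_scaleDl.

Lemma sqz_scaleAl (c : F) (x y : sqz) : c *: (x * y) = (c *: x) * y.
Proof.
case: x y => [a m] [b n]; congr pair; rewrite /= ?scalerAl //.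
by rewrite scalerDr !scalerA -scalerAl mul1r [b * _]mulrC.
Qed.

HB.instance Definition _ := GRing.Lmodule_isLalgebra.Build F sqz sqz_scaleAl.
HB.instance Definition _ := GRing.Lalgebra_isComAlgebra.Build F sqz.

Definition sqz_aug (x : sqz) : F := aug A x.1.

Lemma sqz_aug_lin : linear_for *%R sqz_aug.
Proof. by move=> c x y; rewrite /sqz_aug linearP. Qed.

Lemma sqz_aug_mul : monoid_morphism sqz_aug.
Proof. by split=> [|x y]; rewrite /sqz_aug ?rmorph1 ?rmorphM. Qed.

HB.instance Definition _ :=
  GRing.isLinear.Build F sqz F *%R sqz_aug sqz_aug_lin.
HB.instance Definition _ :=
  GRing.isMonoidMorphism.Build sqz F sqz_aug sqz_aug_mul.

Definition sqzAlg : augAlg F := @AugAlg F sqz sqz_aug.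

Definition sqz_fst_fun (x : sqzAlg) : A := x.1.

Lemma sqz_fst_lin : linear sqz_fst_fun.
Proof. by []. Qed.

Lemma sqz_fst_mul : monoid_morphism sqz_fst_fun.
Proof. by []. Qed.

Definition sqz_fst : augHom sqzAlg A :=
  @AugHom F sqzAlg A sqz_fst_fun sqz_fst_lin sqz_fst_mul (fun _ => erefl).

Section SqzHom.
Variables (T : augAlg F) (t : augHom T A).

Definition isDer (d : T -> N) : Prop :=
  (forall (c : F) x y, d (c *: x + y) = c%:A *: d x + d y) /\
  (forall x y, d (x * y) = t x *: d y + t y *: d x).

Lemma isDer1 d : isDer d -> d 1 = 0.
Proof.
case=> _ /(_ 1 1); rewrite mulr1 rmorph1 !scale1r => e.
by apply: (addrI (d 1)); rewrite -e addr0.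
Qed.

Lemma isDer0 : isDer (fun=> 0).
Proof. by split=> [c x y|x y]; rewrite !scaler0 addr0. Qed.

Lemma isDerN d : isDer d -> isDer (fun x => - d x).
Proof.
case=> d1 d2; split=> [c x y|x y]; first by rewrite d1 opprD scalerN.
by rewrite d2 opprD !scalerN.
Qed.

Lemma isDerD d e : isDer d -> isDer e -> isDer (fun x => d x + e x).
Proof.
case=> d1 d2 [e1 e2]; split=> [c x y|x y].
  by rewrite d1 e1 scalerDr addrACA.
by rewrite d2 e2 !scalerDr addrACA.
Qed.

Section MkDer.
Variables (d : T -> N) (hd : isDer d).

Definition sqz_mk_fun (x : T) : sqzAlg := (t x, d x).

Lemma sqz_mk_lin : linear sqz_mk_fun.
Proof. by move=> c x y; congr pair; rewrite ?linearP // hd.1. Qed.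

Lemma sqz_mk_mul : monoid_morphism sqz_mk_fun.
Proof.
split=> [|x y]; congr pair; rewrite ?rmorph1 ?rmorphM //; first exact: isDer1.
by rewrite hd.2.
Qed.

Definition sqz_mk : augHom T sqzAlg :=
  @AugHom F T sqzAlg sqz_mk_fun sqz_mk_lin sqz_mk_mul (fun x => ahom_aug t x).

Lemma sqz_mk_over : aug_comp sqz_fst sqz_mk = t.
Proof. exact: augHom_eq. Qed.

End MkDer.

Lemma sqz_fstE (s : augHom T sqzAlg) : aug_comp sqz_fst s = t ->
  forall x, (s x).1 = t x.
Proof. by move=> <-. Qed.

Lemma isDer_snd (s : augHom T sqzAlg) : aug_comp sqz_fst s = t ->
  isDer (fun x => (s x).2).
Proof.
move=> /sqz_fstE hs; split=> [c x y|x y]; first by rewrite linearP.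
by rewrite rmorphM /= -!hs.
Qed.

End SqzHom.

Local Notation slice t := (@sliceHom (ComAug F) A sqzAlg _ sqz_fst t).

Definition cslice (T : augAlg F) (t : augHom T A) (d : T -> N)
    (hd : isDer t d) : slice t :=
  exist _ (sqz_mk hd) (sqz_mk_over hd).

Definition csnd (T : augAlg F) (t : augHom T A) (s : slice t) (x : T) : N :=
  ((sval s : augHom T sqzAlg) x).2.

Lemma csnd_der (T : augAlg F) (t : augHom T A) (s : slice t) :
  isDer t (csnd s).
Proof. exact: isDer_snd (svalP s). Qed.

Lemma cslice_eq (T : augAlg F) (t : augHom T A) (r s : slice t) :
  csnd r =1 csnd s -> r = s.
Proof.
move=> e; apply: slice_eq; apply: augHom_eq => x.
rewrite [LHS]surjective_pairing [RHS]surjective_pairing; congr pair; last exact: e.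
by rewrite (sqz_fstE (svalP r)) (sqz_fstE (svalP s)).
Qed.

Definition cslice0 (T : augAlg F) (t : augHom T A) : slice t :=
  cslice (isDer0 t).
Definition csliceN (T : augAlg F) (t : augHom T A) (s : slice t) : slice t :=
  cslice (isDerN (csnd_der s)).
Definition csliceD (T : augAlg F) (t : augHom T A) (r s : slice t) : slice t :=
  cslice (isDerD (csnd_der r) (csnd_der s)).

Lemma csliceDA T t : associative (@csliceD T t).
Proof. by move=> a b c; apply: cslice_eq => x; rewrite /csnd /= addrA. Qed.

Lemma csliceDC T t : commutative (@csliceD T t).
Proof. by move=> a b; apply: cslice_eq => x; rewrite /csnd /= addrC. Qed.

Lemma cslice0D T t : left_id (@cslice0 T t) (@csliceD T t).
Proof. by move=> a; apply: cslice_eq => x; rewrite /csnd /= add0r. Qed.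

Lemma csliceND T t : left_inverse (@cslice0 T t) (@csliceN T t) (@csliceD T t).
Proof. by move=> a; apply: cslice_eq => x; rewrite /csnd /= addNr. Qed.

Lemma cslice_nat (S T : ComAug F) (t : Mor T A) (s : Mor S A) (u : Mor S T)
    (tu : t \oc u = s) (a b : slice t) :
  pull u tu (csliceD a b) = csliceD (pull u tu a) (pull u tu b).
Proof. exact: cslice_eq. Qed.

Definition beckCom : @beck (ComAug F) A :=
  @Beck (ComAug F) A sqzAlg sqz_fst cslice0 csliceN csliceD
    csliceDA csliceDC cslice0D csliceND cslice_nat.

End SquareZero.

Section BinomialModP.
Variables (F : fieldType) (p : nat) (charF : p \in [pchar F]).
Variable A : comAlgType F.

Lemma alg_pchar : p%:R = 0 :> A.
Proof. by rewrite -(rmorph_nat (in_alg A)) (pcharf0 charF) rmorph0. Qed.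

Lemma bin_pred_char k : (k < p)%N -> 'C(p.-1, k)%:R = (-1) ^+ k :> F.
Proof.
have p0 : (0 < p)%N := prime_gt0 (pcharf_prime charF).
elim: k => [|k IH] hk; first by rewrite bin0.
have : 'C(p, k.+1)%:R = 0 :> F by apply: (bin_lt_pcharf_0 charF).
rewrite -{1}(prednK p0) binS natrD IH; last exact: ltnW.
by move/eqP; rewrite addr_eq0 exprS mulN1r => /eqP.
Qed.

Lemma exprD_pred (a b : A) :
  (a + b) ^+ p.-1 = \sum_(0 <= k < p) ((-1) ^+ k : F) *: (a ^+ k * b ^+ (p.-1 - k)).
Proof.
have p0 : (0 < p)%N := prime_gt0 (pcharf_prime charF).
rewrite addrC exprDn big_mkord prednK //; apply: eq_bigr => i _.
by rewrite -(bin_pred_char (ltn_ord i)) scaler_nat mulrC.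
Qed.

Lemma pi_sum_r (a b : A) :
  \sum_(1 <= k < p) ((-1) ^+ k / k%:R : F) *:
     (a ^+ k * ((p - k)%:R * b ^+ (p - k).-1)) =
  b ^+ p.-1 - (a + b) ^+ p.-1.
Proof.
have p0 : (0 < p)%N := prime_gt0 (pcharf_prime charF).
rewrite exprD_pred (big_ltn p0) expr0 scale1r mul1r subn0 opprD addNKr -sumrN.
apply: eq_big_nat => k /andP[k0 kp].
have kn0 : k%:R != 0 :> F by rewrite -(dvdn_pcharf charF) gtnNdvd.
rewrite mulrCA natrB; last exact: ltnW.
rewrite alg_pchar sub0r mulNr scalerN mulr_natl -scaler_nat scalerA divfK //.
by rewrite -subn1 -subnDA addnC subnDA subn1.
Qed.

Lemma pi_sum_l (a b : A) :
  \sum_(1 <= k < p) ((-1) ^+ k / k%:R : F) *: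
     (b ^+ (p - k) * (k%:R * a ^+ k.-1)) =
  a ^+ p.-1 - (a + b) ^+ p.-1.
Proof.
have p0 : (0 < p)%N := prime_gt0 (pcharf_prime charF).
have er (G : nat -> A) :
    \sum_(0 <= k < p) G k = \sum_(0 <= k < p.-1) G k + G p.-1.
  by rewrite -{1}(prednK p0) big_nat_recr.
rewrite exprD_pred er subnn expr0 mulr1 -bin_pred_char ?prednK // binn scale1r.
rewrite opprD addrCA subrr addr0 -{1}(prednK p0) big_add1 /= -sumrN.
apply: eq_big_nat => k /andP[_ kp].
have kp' : (k.+1 < p)%N by rewrite -(prednK p0) ltnS.
have kn0 : k.+1%:R != 0 :> F by rewrite -(dvdn_pcharf charF) gtnNdvd.
rewrite mulrCA mulr_natl -scaler_nat scalerA divfK // exprS mulN1r scaleNr.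
by rewrite mulrC -{1}(prednK p0) subSS.
Qed.

End BinomialModP.

Section PBeck.
Variables (F : fieldType) (p : nat) (charF : p \in [pchar F]).
Variables (B : pCom F p) (M : lmodType (vring B charF)).

(* [theta^* M] *)
Definition thetaMod : lmodType B := restr M (@vtheta F p charF B).

Local Notation E := (sqzAlg thetaMod).

Definition vpi (m : thetaMod) : thetaMod := vf charF B *: (m : M).

Lemma vpiD m n : vpi (m + n) = vpi m + vpi n.
Proof. exact: (scalerDr _ (m : M)). Qed.

Lemma vpiN m : vpi (- m) = - vpi m.
Proof. exact: (scalerN _ (m : M)). Qed.

Lemma vpi0 : vpi 0 = 0.
Proof. exact: (scaler0 M). Qed.

Lemma vpiZ a m : vpi (a *: m) = vtwist p a *: vpi m.
Proof.
rewrite /vpi; change (vf charF B *: (vtheta charF a *: (m : M)) =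
  vtheta charF (vtwist p a) *: (vf charF B *: (m : M))).
by rewrite !scalerA vf_theta.
Qed.

Lemma p_gt0 : (0 < p)%N.
Proof. exact: prime_gt0 (pcharf_prime charF). Qed.

Lemma vtwist0 (a : B) : aug B a = 0 -> vtwist p a = 0.
Proof. by rewrite /vtwist => ->; rewrite (exp0_char charF) scale0r. Qed.

Lemma vtwistZ (c : F) : vtwist p (c%:A : B) = (c ^+ p)%:A.
Proof. by rewrite /vtwist linearZ /= rmorph1 mulr1. Qed.

Definition sqz_pi (x : E) : E := (ppi x.1, vpi x.2 - x.1 ^+ p.-1 *: x.2).

Lemma sqz_pi_aug (x : E) : aug E x = 0 -> aug E (sqz_pi x) = 0.
Proof. exact: ppi_aug. Qed.

Lemma sqz_exp (x : E) n :
  x ^+ n = (x.1 ^+ n, (n%:R * x.1 ^+ n.-1) *: x.2) :> sqz thetaMod.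
Proof.
case: x => a m /=; elim: n => [|n IH]; first by rewrite !expr0 mul0r scale0r.
rewrite exprS IH; congr pair; rewrite /= ?exprS // scalerA -scalerDl.
congr (_ *: _); case: n {IH} => [|n]; first by rewrite !mul0r mulr0 add0r mul1r.
by rewrite /= mulrCA -exprS -[n.+2%:R]natr1 mulrDl mul1r.
Qed.

Lemma sqz_pexp0 (x : E) : aug E x = 0 -> x ^+ p = 0.
Proof.
move=> hx; rewrite sqz_exp (alg_pchar charF) mul0r scale0r.
by congr pair; apply: pexp0.
Qed.

Lemma sqz_sum2 (I : Type) (r : seq I) (P : pred I) (G : I -> E) :
  (\sum_(i <- r | P i) G i).2 = \sum_(i <- r | P i) (G i).2.
Proof. by elim/big_rec2: _ => // i x y _ <-. Qed.

Lemma sqz_sum1 (I : Type) (r : seq I) (P : pred I) (G : I -> E) :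
  (\sum_(i <- r | P i) G i).1 = \sum_(i <- r | P i) (G i).1.
Proof. by elim/big_rec2: _ => // i x y _ <-. Qed.

Lemma sqz_piD (x y : E) : aug E x = 0 -> aug E y = 0 ->
  sqz_pi (x + y) = sqz_pi x + sqz_pi y +
    \sum_(1 <= k < p) ((-1) ^+ k / k%:R : F) *: (x ^+ k * y ^+ (p - k)).
Proof.
move=> hx hy; rewrite [LHS]surjective_pairing [RHS]surjective_pairing.
congr pair => /=.
  rewrite sqz_sum1 ppiD //; congr (_ + _); apply: eq_bigr => k _ /=.
  by rewrite !sqz_exp.
rewrite sqz_sum2.
transitivity (vpi (x.2 + y.2) - x.1 ^+ p.-1 *: x.2 - y.1 ^+ p.-1 *: y.2 +
   ((x.1 ^+ p.-1 - (x.1 + y.1) ^+ p.-1) *: x.2 +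
    (y.1 ^+ p.-1 - (x.1 + y.1) ^+ p.-1) *: y.2)).
  have zid (V : zmodType) (v a b r s : V) :
      v - (r + s) = v - a - b + ((a - r) + (b - s)).
    by rewrite addrACA addKr [v - a + _]addrA subrK opprD addrA.
  by rewrite !scalerBl scalerDr -zid.
rewrite vpiD -(pi_sum_l charF) -(pi_sum_r charF) !scaler_suml -big_split /=.
congr (_ + _); first by rewrite -!addrA; congr (_ + _); rewrite addrCA.
apply: eq_bigr => k _; rewrite !sqz_exp /= scalerDr !scalerA addrC.
by rewrite -!scalerAl !mul1r.
Qed.

Lemma sqz_piM (x y : E) : aug E x = 0 -> aug E y = 0 -> sqz_pi (x * y) = 0.
Proof.
move=> hx hy; congr pair; first exact: ppiM.
rewrite /= vpiD !vpiZ !vtwist0 // !scale0r !add0r scalerDr !scalerA.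
have e (a b : B) : aug B a = 0 -> (a * b) ^+ p.-1 * a = 0.
  by move=> ha; rewrite exprMn mulrAC -exprSr prednK ?p_gt0 // pexp0 ?mul0r.
by rewrite e // [x.1 * _]mulrC e // !scale0r addr0 oppr0.
Qed.

Lemma sqz_piZ (c : F) (x : E) :
  aug E x = 0 -> sqz_pi (c *: x) = c ^+ p *: sqz_pi x.
Proof.
move=> hx; congr pair; first exact: ppiZ.
rewrite /= vpiZ vtwistZ scalerBr; congr (_ - _); rewrite !scalerA.
congr (_ *: _); rewrite exprZn -!scalerAl mul1r -scalerAr mulr1 scalerA.
by rewrite -exprSr prednK ?p_gt0.
Qed.

Definition sqzP : pCom F p :=
  PComPack sqz_pi_aug sqz_pexp0 sqz_piD sqz_piM sqz_piZ.

Definition sqzP_fst : pHom sqzP B := @PHom F p sqzP B (sqz_fst thetaMod) (fun _ _ => erefl).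

Section PSlice.
Variables (T : pCom F p) (t : pHom T B).

Definition isPDer (d : T -> thetaMod) : Prop :=
  isDer t d /\
  forall x, aug T x = 0 -> d (ppi x) = vpi (d x) - t x ^+ p.-1 *: d x.

Lemma isPDer0 : isPDer (fun=> 0).
Proof.
by split=> [|x _]; [exact: isDer0 | rewrite vpi0 scaler0 subr0].
Qed.

Lemma isPDerN d : isPDer d -> isPDer (fun x => - d x).
Proof.
case=> h1 h2; split=> [|x hx]; first exact: isDerN.
by rewrite h2 // vpiN scalerN opprD.
Qed.

Lemma isPDerD d e : isPDer d -> isPDer e -> isPDer (fun x => d x + e x).
Proof.
case=> h1 h2 [g1 g2]; split=> [|x hx]; first exact: isDerD.
by rewrite h2 // g2 // vpiD scalerDr opprD addrACA.
Qed.

Local Notation slice := (@sliceHom (PCom F p) B sqzP _ sqzP_fst t).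

Lemma pslice_pi (d : T -> thetaMod) (hd : isPDer d) x :
  aug T x = 0 -> sqz_mk hd.1 (ppi x) = sqz_pi (sqz_mk hd.1 x).
Proof. by move=> hx; congr pair; rewrite /= ?phom_pi // hd.2. Qed.

Lemma pslice_over (d : T -> thetaMod) (hd : isPDer d) :
  p_comp sqzP_fst (@PHom F p T sqzP (sqz_mk hd.1) (pslice_pi hd)) = t.
Proof. exact: pHom_eq. Qed.

Definition pslice (d : T -> thetaMod) (hd : isPDer d) : slice :=
  exist _ (@PHom F p T sqzP (sqz_mk hd.1) (pslice_pi hd)) (pslice_over hd).

Definition psnd (s : slice) (x : T) : thetaMod := ((sval s : pHom T sqzP) x).2.

Lemma slice_over (s : slice) :
  aug_comp (sqz_fst thetaMod) (sval s : pHom T sqzP) = t.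
Proof. exact: (congr1 (fun f : pHom T B => phom f) (svalP s)). Qed.

Lemma psnd_der (s : slice) : isPDer (psnd s).
Proof.
split; first exact: isDer_snd (slice_over s).
by move=> x hx; rewrite /psnd phom_pi //= (sqz_fstE (slice_over s)).
Qed.

Lemma pslice_eq (r s : slice) : psnd r =1 psnd s -> r = s.
Proof.
move=> e; apply: slice_eq; apply: pHom_eq => x.
rewrite [LHS]surjective_pairing [RHS]surjective_pairing; congr pair; last exact: e.
by rewrite (sqz_fstE (slice_over r)) (sqz_fstE (slice_over s)).
Qed.

Definition pslice0 : slice := pslice isPDer0.
Definition psliceN (s : slice) : slice := pslice (isPDerN (psnd_der s)).
Definition psliceD (r s : slice) : slice :=
  pslice (isPDerD (psnd_der r) (psnd_der s)).

Lemma psliceDA : associative psliceD.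
Proof. by move=> a b c; apply: pslice_eq => x; rewrite /psnd /= addrA. Qed.

Lemma psliceDC : commutative psliceD.
Proof. by move=> a b; apply: pslice_eq => x; rewrite /psnd /= addrC. Qed.

Lemma pslice0D : left_id pslice0 psliceD.
Proof. by move=> a; apply: pslice_eq => x; rewrite /psnd /= add0r. Qed.

Lemma psliceND : left_inverse pslice0 psliceN psliceD.
Proof. by move=> a; apply: pslice_eq => x; rewrite /psnd /= addNr. Qed.

End PSlice.

Lemma pslice_nat (S T : PCom F p) (t : Mor T B) (s : Mor S B) (u : Mor S T)
    (tu : t \oc u = s) (a b : sliceHom (sqzP_fst : Mor (sqzP : PCom F p) B) t) :
  pull u tu (psliceD a b) = psliceD (pull u tu a) (pull u tu b).
Proof. exact: pslice_eq. Qed.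

Definition beckP : @beck (PCom F p) B :=
  @Beck (PCom F p) B sqzP sqzP_fst pslice0 psliceN psliceD
    psliceDA psliceDC pslice0D psliceND pslice_nat.

End PBeck.

Lemma add_zmod_morphism (U V : zmodType) (f : U -> V) :
  {morph f : a b / a + b} -> zmod_morphism f.
Proof. by move=> fD a b; apply: (addIr (f b)); rewrite -fD !subrK. Qed.

Section Comparison1.
Variables (F : fieldType) (p : nat) (charF : p \in [pchar F]).
Variables (L : left_adjoint (forget F p)) (A : augAlg F).
Variable M : lmodType (vring (L A : pCom F p) charF).

Local Notation eta X := (adj_unit L X : augHom X (L X : pCom F p)).

(* [M] as an [A]-module, by restriction along the unit *)
Definition unitMod : lmodType A := restr (thetaMod M) (eta A).

Section Transpose.
Variables (T : augAlg F) (t : augHom T A).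
Local Notation Lt := (fmor L (t : Mor (T : ComAug F) A)).

Definition transpose_snd (s : beckHom (beckP M) Lt) (x : T) : unitMod :=
  psnd s (eta T x).

Lemma unit_natE x : (Lt : pHom _ _) (eta T x) = eta A (t x).
Proof.
exact: (congr1 (fun f : augHom T (L A : pCom F p) => f x)
  (esym (adj_unit_nat L (t : Mor (T : ComAug F) A)))).
Qed.

Lemma transpose_der (s : beckHom (beckP M) Lt) : isDer t (transpose_snd s).
Proof.
have [[h1 h2] _] := psnd_der s; split=> [c x y|x y]; rewrite /transpose_snd.
  rewrite linearP h1; congr (_ + _).
  change (c%:A *: psnd s (eta T x) = eta A (c%:A) *: psnd s (eta T x)).
  by rewrite linearZ /= rmorph1.
by rewrite rmorphM h2 !unit_natE.
Qed.

(* [Hom_{/L A}(L T, E) -> Hom_{/A}(T, eta^* U E)]: compose with the unit of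
   [T], then factor through the pullback of [L A (+) M] along [eta A], which is
   [A (+) unitMod]. *)
Definition transpose (s : beckHom (beckP M) Lt) :
    beckHom (beckCom unitMod) (t : Mor (T : ComAug F) A) :=
  cslice (transpose_der s).

Lemma transpose_zmod : zmod_morphism transpose.
Proof. by apply: add_zmod_morphism => a b; apply: cslice_eq. Qed.

HB.instance Definition _ := GRing.isZmodMorphism.Build _ _ transpose transpose_zmod.

End Transpose.

Section DerTranspose.
Variable C : @sover (ComAug F) A.

Definition der_transpose_n n :
    {additive der (beckP M) (sfun L C) n -> der (beckCom unitMod) C n} :=
  @transpose (C n) (sproj C n).

Lemma der_transpose_nat m n (a : mono m n) x :
  der_transpose_n n (cact (der (beckP M) (sfun L C)) a x) =
  cact (der (beckCom unitMod) C) a (der_transpose_n m x).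
Proof.
apply: cslice_eq => y.
change (psnd x ((fmor L (sact C a) : pHom _ _) (eta (C n) y)) =
        psnd x (eta (C m) ((sact C a : augHom _ _) y))).
congr (psnd x _).
exact: (congr1 (fun f : augHom (C n) (L (C m) : pCom F p) => f y)
  (esym (adj_unit_nat L (sact C a)))).
Qed.

Definition der_transpose :
    cmap (der (beckP M) (sfun L C)) (der (beckCom unitMod) C) :=
  CMap der_transpose_nat.

End DerTranspose.

Definition comparison1 (C : @sover (ComAug F) A) (D : @sover (PCom F p) (L A))
    (phi : overMap (sfun L C) D) :
    cmap (der (beckP M) D) (der (beckCom unitMod) C) :=
  ccomp (der_transpose C) (der_pre (beckP M) phi).

End Comparison1.

Section Comparison2.
Variables (F : fieldType) (p : nat) (charF : p \in [pchar F]).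
Variables (B : pCom F p) (M : lmodType (vring B charF)).
Local Notation U := (forget F p).

Section ForgetSlice.
Variables (T : pCom F p) (t : pHom T B).

Lemma forget_over (s : beckHom (beckP M) (t : Mor (T : PCom F p) B)) :
  aug_comp (sqz_fst (thetaMod M)) (fmor U (sval s)) = t.
Proof. exact: slice_over. Qed.

Definition forget_slice (s : beckHom (beckP M) (t : Mor (T : PCom F p) B)) :
    beckHom (beckCom (thetaMod M)) (phom t : Mor (palg T : ComAug F) (palg B)) :=
  exist _ (fmor U (sval s)) (forget_over s).

Lemma forget_slice_zmod : zmod_morphism forget_slice.
Proof. by apply: add_zmod_morphism => a b; apply: cslice_eq. Qed.

HB.instance Definition _ :=
  GRing.isZmodMorphism.Build _ _ forget_slice forget_slice_zmod.

End ForgetSlice.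

Section DerForget.
Variable D : @sover (PCom F p) B.

Definition der_forget_n n :
    {additive der (beckP M) D n -> der (beckCom (thetaMod M)) (sfun U D) n} :=
  @forget_slice (D n) (sproj D n).

Lemma der_forget_nat m n (a : mono m n) x :
  der_forget_n n (cact (der (beckP M) D) a x) =
  cact (der (beckCom (thetaMod M)) (sfun U D)) a (der_forget_n m x).
Proof. exact: cslice_eq. Qed.

Definition der_forget :
    cmap (der (beckP M) D) (der (beckCom (thetaMod M)) (sfun U D)) :=
  CMap der_forget_nat.

End DerForget.

Definition comparison2 (D : @sover (PCom F p) B) (C : @sover (ComAug F) (U B))
    (psi : overMap C (sfun U D)) :
    cmap (der (beckP M) D) (der (beckCom (thetaMod M)) C) :=
  ccomp (der_pre (beckCom (thetaMod M)) psi) (der_forget D).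

End Comparison2.

(* Main.v *)
Require Import Defs.
From HB Require Import structures.
From mathcomp Require Import all_boot all_order all_algebra boolp zify.
Set Implicit Arguments.
Unset Strict Implicit.
Unset Printing Implicit Defensive.
Import GRing.Theory.
Local Open Scope ring_scope.

(** Let [C -> X] and [Y -> X] be simplicial objects over a constant one, with [C]
    cofibrant and [Y -> X] a weak equivalence. The comparison maps exist and are
    well defined because there is a map [C -> Y] over [X] and any two such maps
    are homotopic over [X], so that they agree on the cohomology of derivations.

    The map exists because a weak equivalence to a constant object is already a
    trivial fibration. All fillings that are needed come from one statement,
    [simplex_extension]: a map from a sub-simplicial set of a standard simplex to
    [Y] over a point of [X] extends to the whole simplex.

    For the homotopy, the path object is not the function space from [Delta 1]
    but the doubling [dbl Y], which in degree n is the value of [Y] at the join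
    of two copies of the ordinal [n]. It is a mere reindexing of [Y], hence makes
    sense in any category and is preserved by the forgetful functor, and a map
    [C -> dbl Y] determines a simplicial homotopy between its two ends, since
    [Delta n x Delta 1] maps to the join. For augmented algebras, restriction to
    the two ends is a trivial fibration from [dbl Y] to the fibre square of [Y]
    over [X] ([ends_trivial_fibration]), so a pair of maps to [Y] lifts to
    [dbl Y] ([cofibrant_homotopic]). A homotopy gives a cochain homotopy on
    derivations by the usual triangulation of the prism
    ([homotopic_cohomotopy]).

    For the forgetful functor this applies directly, with [Y] the underlying
    simplicial algebra of a replacement of [B]. For its left adjoint, maps from
    [L C] to [D] or to [dbl D] are the same as maps from [C] to [U D] or to
    [U (dbl D) = dbl (U D)]: both the comparison map and the homotopy are
    transposed, and the homotopy between maps out of [L C] induces the cochain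
    homotopy on derivations with divided powers. In both cases naturality
    follows from independence of the choice, the two composites being the maps
    induced by two choices. *)

(** * Monotone maps *)

Lemma mono_compA m n q r (c : mono q r) (b : mono n q) (a : mono m n) :
  mono_comp (mono_comp c b) a = mono_comp c (mono_comp b a).
Proof. exact: mono_eq. Qed.

Lemma mono_comp_inj m n q (g : mono m n) (a b : mono q m) :
  injective g -> mono_comp g a = mono_comp g b -> a = b.
Proof.
move=> g_inj e; apply: mono_eq => i; apply: g_inj.
exact: (congr1 (fun h : mono q n => h i) e).
Qed.

(** Monotonicity of the factor comes for free, since an injective monotone map
    reflects the order. *)
Lemma mono_factor m n q (g : mono m n) (a : mono q n) :
  injective g -> (forall i, exists j, g j = a i) ->
  exists b : mono q m, a = mono_comp g b.
Proof.
move=> g_inj /choice[f fP].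
have f_le (i j : 'I_q.+1) : (i <= j)%N -> (f i <= f j)%N.
  move=> ij; rewrite leqNgt; apply/negP => fji.
  suff e : f i = f j by rewrite e ltnn in fji.
  apply: g_inj; apply/val_inj/anti_leq/andP; split=> /=.
    by rewrite !fP mfun_le.
  by rewrite mfun_le // ltnW.
by exists (Mono f_le); apply: mono_eq => i /=; rewrite fP.
Qed.

Lemma mono_section m n (b : mono m n) :
  (forall i, exists j, b j = i) -> exists s, mono_comp b s = mono_id n.
Proof.
move=> /choice[s sP].
have s_le (i j : 'I_n.+1) : (i <= j)%N -> (s i <= s j)%N.
  move=> ij; rewrite leqNgt; apply/negP => sji.
  suff e : i = j by rewrite e ltnn in sji.
  apply/val_inj/anti_leq; rewrite ij /= -{1}(sP i) -{1}(sP j).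
  by rewrite mfun_le // ltnW.
by exists (Mono s_le); apply: mono_eq.
Qed.

Lemma coface_inj n (i : 'I_n.+2) : injective (coface i).
Proof. exact: lift_inj. Qed.

Lemma coface_factor m n (a : mono m n.+1) i :
  (forall j, a j != i) -> exists b, a = mono_comp (coface i) b.
Proof.
move=> ai; apply: mono_factor (@coface_inj n i) _ => j.
by case: (unliftP i (a j)) (ai j) => [k ->|->]; [exists k | rewrite eqxx].
Qed.

(** A surjective monotone map has a monotone section, any choice of preimages;
    one that misses a vertex factors through the opposite face. *)
Lemma mono_section_or_face m n (b : mono m n.+1) :
  (exists s, mono_comp b s = mono_id n.+1) \/
  (exists i c, b = mono_comp (coface i) c).
Proof.
have [h|] := pselect (forall i, exists j, b j = i).
  by left; apply: mono_section.
move=> /existsNP[i /forallNP h]; right; exists i.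
by apply: coface_factor => j; apply/eqP; apply: h.
Qed.

Lemma mono_section0 m (b : mono m 0) : exists s, mono_comp b s = mono_id 0.
Proof. by apply: mono_section => i; exists ord0; rewrite !ord1. Qed.

Lemma codegen_le n (j : 'I_n.+1) (i k : 'I_n.+2) : (i <= k)%N ->
  ((inord (unbump j i) : 'I_n.+1) <= (inord (unbump j k) : 'I_n.+1))%N.
Proof.
have h (l : 'I_n.+2) : (unbump j l < n.+1)%N.
  by have := ltn_ord l; have := ltn_ord j; rewrite /unbump; lia.
by move=> ik; rewrite !inordK //; rewrite /unbump; lia.
Qed.

(** The degeneracy that identifies the vertices [j] and [j.+1]. *)
Definition codegen n (j : 'I_n.+1) : mono n.+1 n :=
  @Mono n.+1 n (fun i => inord (unbump j i)) (@codegen_le n j).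

Lemma codegenE n (j : 'I_n.+1) i : codegen j i = unbump j i :> nat.
Proof.
rewrite /= inordK //.
by have := ltn_ord i; have := ltn_ord j; rewrite /unbump; lia.
Qed.

Lemma codegen_face n (j : 'I_n.+1) (i : 'I_n.+2) : i = j.+1 :> nat ->
  mono_comp (codegen j) (coface i) = mono_id n.
Proof.
move=> ij; apply: mono_eq => k; apply: ord_inj.
by rewrite [LHS]codegenE /= ij /unbump /bump; lia.
Qed.

Lemma face_codegen n (j : 'I_n.+1) (i : 'I_n.+2) k : i = j.+1 :> nat ->
  val (coface i (codegen j k)) = if k == i then val j else val k.
Proof.
move=> ij; have := codegenE j k; rewrite -val_eqE /= ij => ->.
by rewrite /unbump /bump; case: eqP; lia.
Qed.

(** A map that is not injective takes the same value at two consecutive vertices,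
    hence is unchanged by collapsing one of them to the other. *)
Lemma mono_injP m n (a : mono m.+1 n) :
  injective a \/ exists (i : 'I_m.+2) (s : mono m.+1 m),
    mono_comp a (mono_comp (coface i) s) = a.
Proof.
have [h|] := pselect (exists j : 'I_m.+1, a (inord j) = a (inord j.+1)).
  right; case: h => j aj; have jm := ltn_ord j.
  have ij : (inord j.+1 : 'I_m.+2) = j.+1 :> nat by rewrite inordK.
  exists (inord j.+1), (codegen j).
  apply: mono_eq => k; have := face_codegen k ij.
  case: eqP => [->|_] /= e; last by congr (a _); apply: val_inj.
  rewrite -aj; congr (a _); apply: val_inj; rewrite /= e inordK //.
  exact: ltnW.
move=> /forallNP h; left=> i j.
wlog ij : i j / (i < j)%N => [H e|e].
  by have [/H/(_ e)|/H/(_ (esym e))|/val_inj] := ltngtP i j.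
have hj := ltn_ord j; have im : (i < m.+1)%N by lia.
case: (h (Ordinal im)) => /=; apply/val_inj/anti_leq/andP; split.
  by rewrite mfun_le // !inordK //; lia.
have -> : (inord i : 'I_m.+2) = i by apply: val_inj; rewrite /= inordK //; lia.
by rewrite e mfun_le // inordK //; lia.
Qed.

(** * Extension of simplices *)

Section Action.
Variables (K : algCat) (Y : sobj K).

Definition act m n (a : mono m n) (y : und (Y n)) : und (Y m) :=
  undm (sact Y a) y.

Lemma act_comp m n q (b : mono n q) (a : mono m n) y :
  act (mono_comp b a) y = act a (act b y).
Proof. by rewrite /act sactM undmM. Qed.

Lemma act_id n (y : und (Y n)) : act (mono_id n) y = y.
Proof. by rewrite /act sact1 undm1. Qed.

HB.instance Definition _ m n (a : mono m n) :=
  GRing.isZmodMorphism.Build _ _ (act a) (raddfB (undm (sact Y a))).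

End Action.

Arguments act {K} Y {m n}.

Definition agree_on_overlaps (K : algCat) (Y : sobj K) n (I : pred 'I_n.+2)
    (v : 'I_n.+2 -> und (Y n)) :=
  forall i j, I i -> I j -> forall q (a b : mono q n),
    mono_comp (coface i) a = mono_comp (coface j) b ->
    act Y a (v i) = act Y b (v j).


Lemma act_smap (K : algCat) (X Y : sobj K) (f : smap X Y) m n (a : mono m n) x :
  act Y a (undm (f n) x) = undm (f m) (act X a x).
Proof. by rewrite /act -!undmM smap_nat. Qed.

Lemma act_sconst (K : algCat) (X : K) m n (a : mono m n) x :
  act (sconst X) a x = x.
Proof. exact: undm1. Qed.

Section AugmentedAcyclic.
Variables (K : algCat) (X : K) (Y : sover X).
Local Notation aug_ n := (undm (sproj Y n)).

Lemma aug_act m n (a : mono m n) y : aug_ m (act Y a y) = aug_ n y.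
Proof. by rewrite /act -undmM sproj_nat. Qed.

Hypothesis acyclicY : weak_equivalence (saug Y).

Lemma aug_surj n (x : und X) : exists y, aug_ n y = x.
Proof.
have [_ /(_ x I)[y _ [z [z0 z1]]]] := acyclicY 0.
(* the faces of a constant object are identities, so boundaries vanish *)
have e : z = 0 by rewrite -(z0 ord_max) // /face undm1.
pose c := @Mono n 0 (fun=> ord0) (fun _ _ _ => leqnn 0).
exists (act Y c y); rewrite aug_act.
by apply/esym/eqP; rewrite -subr_eq0 -z1 e /face raddf0.
Qed.

(** Moore's argument: the faces other than the zeroth are made correct one at a
    time, from the last one down, by adding a degenerate simplex. *)
Lemma moore_filler n (v : 'I_n.+2 -> und (Y n)) :
  agree_on_overlaps predT v ->
  exists w, forall i, i != ord0 -> act Y (coface i) w = v i.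
Proof.
move=> vv.
suff /(_ n.+1)[w hw] : forall k, exists w, forall i : 'I_n.+2,
    i != ord0 -> (n.+1 < k + i)%N -> act Y (coface i) w = v i.
  exists w => i i0; apply: hw => //; rewrite -[X in (X < _)%N]addn0 ltn_add2l.
  by rewrite lt0n.
elim=> [|k [w hw]].
  by exists 0 => i _; rewrite add0n; have := ltn_ord i; lia.
have [kn|kn] := ltnP n k.
  exists w => i i0 _; apply: hw => //.
  have : (0 < i)%N by rewrite lt0n.
  by lia.
pose j : 'I_n.+1 := inord (n - k); pose i : 'I_n.+2 := inord (n - k).+1.
have ij : i = j.+1 :> nat by rewrite !inordK //; lia.
exists (w + act Y (codegen j) (v i - act Y (coface i) w)) => l l0 hl.
rewrite raddfD /= -act_comp.
have [->|li] := eqVneq l i.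
  by rewrite (codegen_face ij) act_id addrC subrK.
have il : (i < l)%N.
  by move: li; rewrite -val_eqE /= /i inordK; lia.
rewrite hw //; last by move: il; rewrite /i inordK; lia.
(* on the later faces the correction vanishes by compatibility *)
have [e el] : exists e,
    mono_comp (coface i) (mono_comp (codegen j) (coface l)) = mono_comp (coface l) e.
  apply: coface_factor => k'; rewrite -val_eqE.
  have -> := face_codegen (coface l k') ij.
  case: ifP => _; first by move: il; rewrite ij /=; lia.
  by rewrite val_eqE eq_sym; apply: neq_lift.
rewrite raddfB /= (vv i l isT isT _ _ _ el) -act_comp el act_comp hw ?subrr ?addr0 //.
by move: il; rewrite /i inordK; lia.
Qed.

(** The simplex that fills all faces but the zeroth is corrected by a bounding
    chain of the defect on that face, which is a cycle over zero. *)
Lemma boundary_filler n (v : 'I_n.+2 -> und (Y n)) x :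
  agree_on_overlaps predT v -> (forall i, aug_ n (v i) = x) ->
  exists w, forall i, act Y (coface i) w = v i.
Proof.
move=> vv vx; have [w hw] := moore_filler vv.
pose u := v ord0 - act Y (coface ord0) w.
have cu : scycle u.
  rewrite /u; case: n v vv vx w hw @u => [//|n] v vv _ w hw u i.
  have [e he] : exists e, mono_comp (coface ord0) (coface i) =
      mono_comp (coface (lift ord0 i)) e.
    apply: coface_factor => k; rewrite -val_eqE /= /bump; lia.
  rewrite [face i _](raddfB (act Y (coface i))) /= (vv _ _ isT isT _ _ _ he).
  by rewrite -act_comp he act_comp hw ?subrr.
have [h _] := acyclicY n; case: (h u cu) => [|z [z0 z1]].
  exists 0; split; first by move=> i _; rewrite /face raddf0.
  rewrite /face raddf0 /= /u raddfB /= vx aug_act.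
  have := aug_act (coface (ord_max : 'I_n.+2)) w.
  by rewrite hw // vx => ->; rewrite subrr.
exists (w + z) => i; rewrite raddfD /=; have [->|i0] := eqVneq i ord0.
  by rewrite [X in _ + X]z1 addrC subrK.
by rewrite hw // [X in _ + X]z0 // addr0.
Qed.

End AugmentedAcyclic.

Section Extension.
Variables (K : algCat) (X : K) (Y : sover X).
Hypothesis acyclicY : weak_equivalence (saug Y).
Variables (N : nat) (x : und X).

Section Family.
Variables (G : Type) (d : G -> nat) (g : forall t, mono (d t) N).

Definition covered q (a : mono q N) :=
  exists t (b : mono q (d t)), a = mono_comp (g t) b.

Lemma covered_comp q r (a : mono q N) (b : mono r q) :
  covered a -> covered (mono_comp a b).
Proof. by case=> t [c ->]; exists t, (mono_comp c b); rewrite mono_compA. Qed.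

Definition compatible (y : forall t, und (Y (d t))) :=
  (forall t, undm (sproj Y (d t)) (y t) = x) /\
  (forall t u q (a : mono q (d t)) (b : mono q (d u)),
     mono_comp (g t) a = mono_comp (g u) b -> act Y a (y t) = act Y b (y u)).

Definition mono_image q (a : mono q N) : {set 'I_N.+1} := [set a i | i : 'I_q.+1].

(** The faces of the simplex that are still missing: their number is what
    decreases when a face is added. *)
Definition uncovered_images : {set {set 'I_N.+1}} :=
  [set s | `[< exists q (a : mono q N), mono_image a = s /\ ~ covered a >]].

(** In least dimension, an uncovered simplex is injective, for it would otherwise
    factor through a smaller uncovered one, and likewise its faces are covered. *)
Lemma minimal_uncovered : ~ covered (mono_id N) ->
  exists m (a : mono m N), [/\ ~ covered a, injective a &
    forall r (b : mono r m), covered (mono_comp a b) \/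
                             exists s, mono_comp b s = mono_id m].
Proof.
move=> h; have exP : exists m, `[< exists a : mono m N, ~ covered a >].
  by exists N; apply/asboolP; exists (mono_id N).
case: (ex_minnP exP) => m /asboolP[a ha] min; exists m, a; split=> //.
  case: m a ha min => [|m] a ha min; first by move=> i j _; rewrite !ord1.
  have [//|[i [s e]]] := mono_injP a; exfalso.
  have /min : `[< exists a : mono m N, ~ covered a >].
    apply/asboolP; exists (mono_comp a (coface i)) => c; apply: ha; rewrite -e.
    by rewrite -mono_compA; apply: covered_comp.
  by rewrite ltnn.
move=> r b; case: m a ha b min => [|m] a ha b min.
  by right; apply: mono_section0.
have [|[i [c ->]]] := mono_section_or_face b; first by right.
left; rewrite -mono_compA; apply: covered_comp; apply: contrapT => hc.
have /min : `[< exists a : mono m N, ~ covered a >].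
  by apply/asboolP; exists (mono_comp a (coface i)).
by rewrite ltnn.
Qed.

End Family.

(** Missing faces are added one by one, in order of dimension, each by filling
    its boundary. The generators [g t] and their images [y t] encode a map from a
    sub-simplicial set of the standard simplex to [Y] over [x]; in this form,
    adding a face is just adding a generator. *)
Lemma simplex_extension (G : Type) (d : G -> nat) (g : forall t, mono (d t) N)
    (y : forall t, und (Y (d t))) : compatible g y ->
  exists w : und (Y N),
    undm (sproj Y N) w = x /\ forall t, act Y (g t) w = y t.
Proof.
have [k] := ubnP #|uncovered_images g|.
elim: k => // k IH in G d g y * => hk [yx yy].
(* if the top simplex is covered, its image is the extension *)
have [[t [b idb]]|nid] := pselect (covered g (mono_id N)).
  exists (act Y b (y t)); split; first by rewrite aug_act.
  move=> u; rewrite -act_comp.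
  transitivity (act Y (mono_id _) (y u)); last exact: act_id.
  by apply: yy; rewrite -mono_compA -idb; apply: mono_eq.
have [m [a [ha a_inj abd]]] := minimal_uncovered nid.
have [w0 [w0x w0b]] : exists w0, undm (sproj Y m) w0 = x /\
    forall r (b : mono r m) t (c : mono r (d t)),
      mono_comp a b = mono_comp (g t) c -> act Y b w0 = act Y c (y t).
  case: m a ha a_inj abd => [|m] a ha a_inj abd.
    have [w0 w0x] := aug_surj acyclicY 0 x; exists w0; split=> // r b t c e.
    have [s bs] := mono_section0 b; case: ha; exists t, (mono_comp c s).
    by rewrite -mono_compA -e mono_compA bs; apply: mono_eq.
  have /choice[f fP] : forall i : 'I_m.+2, exists v, exists t (c : mono m (d t)),
      mono_comp a (coface i) = mono_comp (g t) c /\ v = act Y c (y t).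
    move=> i; have [[t [c e]]|[s bs]] := abd _ (coface i).
      by exists (act Y c (y t)), t, c.
    have /(congr1 (fun f : mono _ _ => f i)) /= e := bs.
    by have := neq_lift i (s i); rewrite e eqxx.
  have fx i : undm (sproj Y m) (f i) = x.
    by have [t [c [_ ->]]] := fP i; rewrite aug_act.
  have ff : agree_on_overlaps predT f.
    move=> i j _ _ q b c e; have [t [bt [ht ->]]] := fP i.
    have [u [cu [hu ->]]] := fP j; rewrite -!act_comp; apply: yy.
    by rewrite -!mono_compA -ht -hu !mono_compA e.
  have [w0 hw0] := boundary_filler acyclicY ff fx.
  exists w0; split=> [|r b t c e].
    by rewrite -(fx ord0) -hw0 aug_act.
  have [[s bs]|[i [b' eb]]] := mono_section_or_face b.
    case: ha; exists t, (mono_comp c s).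
    by rewrite -mono_compA -e mono_compA bs; apply: mono_eq.
  rewrite eb act_comp hw0; have [u [cu [hu ->]]] := fP i.
  rewrite -act_comp; apply: yy.
  by rewrite -e eb -!mono_compA hu.
(* [a] becomes a new generator, with the filler of its boundary as image *)
pose d' (o : option G) := if o is Some t then d t else m.
pose g' (o : option G) : mono (d' o) N := if o is Some t then g t else a.
pose y' (o : option G) : und (Y (d' o)) := if o is Some t then y t else w0.
have cov' q (b : mono q N) : covered g b -> covered g' b.
  by case=> t [c ->]; exists (Some t), c.
have [||w [wx wy]] := IH _ d' g' y'.
- apply: leq_trans (_ : #|uncovered_images g| <= k)%N; last by rewrite -ltnS.
  apply: proper_card; apply/properP; split.
    apply/subsetP => s; rewrite !inE => /asboolP[q [b [bs hb]]].
    by apply/asboolP; exists q, b; split=> // /cov'.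
  exists (mono_image a); rewrite inE; apply/asboolP; first by exists m, a.
  move=> [q [b [bs]]]; case; exists None; apply: mono_factor => // i.
  have : b i \in mono_image a by rewrite -bs; apply: imset_f.
  by case/imsetP => j _ ->; exists j.
- split=> [[t|]|] //=.
  move=> [t|] [u|] q b c /= e; first exact: yy.
  + exact/esym/w0b.
  + exact: w0b.
  + by rewrite (mono_comp_inj a_inj e).
- by exists w; split=> // t; apply: (wy (Some t)).
Qed.

End Extension.

(** * Trivial fibrations *)

(** Relative form of filling where any set of faces may be prescribed, which
    covers both horns and boundaries. *)
Definition fills_faces (K : algCat) (Y Z : sobj K) (f : smap Y Z) : Prop :=
  forall n (I : pred 'I_n.+2) (y : 'I_n.+2 -> und (Y n)) (z : und (Z n.+1)),
    agree_on_overlaps I y ->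
    (forall i, I i -> act Z (coface i) z = undm (f n) (y i)) ->
    exists x : und (Y n.+1),
      (forall i, I i -> act Y (coface i) x = y i) /\ undm (f n.+1) x = z.

(** The simplices that the zeroth face shares with another face lie on a face of
    the zeroth face: a cycle can thus be put on one face of a boundary, with zero
    on the other ones. *)
Lemma scycle_overlap (K : algCat) (Y : sobj K) n (x : und (Y n)) :
  scycle x -> forall j q (a b : mono q n), j != ord0 ->
  mono_comp (coface ord0) a = mono_comp (coface j) b -> act Y a x = 0.
Proof.
move=> cx j q a b j0 e.
have e' i : bump 0 (a i) = bump j (b i).
  by have /(congr1 (fun f : mono _ _ => val (f i))) := e.
case: n x cx j a b j0 e e' => [|n] x cx j a b j0 e e'.
  have := e' ord0; rewrite !ord1; move: j0; rewrite -lt0n /bump /=; lia.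
have [k ej|ej] := unliftP ord0 j; last by rewrite ej eqxx in j0.
subst j; have [c ->] : exists c, a = mono_comp (coface k) c.
  apply: coface_factor => i; have := e' i; rewrite -val_eqE /= /bump /=; lia.
by rewrite act_comp [act Y _ x]cx raddf0.
Qed.

Lemma sbound0 (K : algCat) (Y : sobj K) n : sbound (0 : und (Y n)).
Proof. by exists 0; split=> [i _|]; rewrite /face raddf0. Qed.

(** Horns are the case where all faces but one are given; prescribing all faces,
    or none, lets one lift boundaries and cycles. *)
Lemma fills_faces_trivial_fibration (K : algCat) (Y Z : sobj K) (f : smap Y Z) :
  fills_faces f -> trivial_fibration f.
Proof.
move=> ff; split; first by move=> n k y z yy yz; apply: (ff n (predC1 k)).
move=> n; split.
  move=> x cx [z [z0 z1]].
  have [|i _|w [wx _]] := ff n predT (fun i => if i == ord0 then x else 0) z.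
  - move=> i j _ _ q a b; have [->|i0] := eqVneq i ord0.
      have [->|j0] := eqVneq j ord0.
        by move=> /(mono_comp_inj (@coface_inj _ _)) ->.
      by move=> e; rewrite raddf0 (scycle_overlap cx j0 e).
    have [->|j0] := eqVneq j ord0; last by rewrite !raddf0.
    by move=> e; rewrite raddf0 (scycle_overlap cx i0 (esym e)).
  - by have [->|i0] := eqVneq i ord0; rewrite ?raddf0; [apply: z1 | apply: z0].
  exists w; split=> [i i0|]; first by rewrite [LHS]wx // (negPf i0).
  by rewrite [LHS]wx.
case: n => [|n] y cy.
  have [||x [_ fx]] := ff 0 pred0 (fun=> 0) (act Z (codegen ord0) y); try by [].
  exists (act Y (coface ord_max) x) => //.
  rewrite -act_smap fx -act_comp codegen_face // act_id subrr.
  exact: sbound0.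
have [||x [x0 fx]] := ff n predT (fun=> 0) y.
- by move=> i j _ _ q a b _; rewrite !raddf0.
- by move=> i _; rewrite raddf0; apply: cy.
exists x; first by move=> i; apply: x0.
by rewrite fx subrr; apply: sbound0.
Qed.

Lemma acyclic_fills_faces (K : algCat) (X : K) (Y : sover X) :
  weak_equivalence (saug Y) -> fills_faces (saug Y).
Proof.
move=> acyclicY n I y z yy yz.
have [|w [wz wy]] := @simplex_extension K X Y acyclicY n.+1 z {i | I i}
  (fun=> n) (fun i => coface (sval i)) (fun i => y (sval i)).
- split=> [[i Ii]|[i Ii] [j Ij] q a b /= e]; last exact: yy.
  by rewrite -[LHS]yz // act_sconst.
by exists w; split=> // i Ii; apply: (wy (exist _ i Ii)).
Qed.

(** * The doubling *)

(** The join of two n-simplices has ['I_(n.+1 + n.+1)] as vertices, which is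
    convertible to ['I_(n + n.+1).+1]: it is a simplex of dimension
    [n + n.+1]. *)
Definition copy_fun (s : bool) n (i : 'I_n.+1) : 'I_(n + n.+1).+1 :=
  if s then @rshift n.+1 n.+1 i else @lshift n.+1 n.+1 i.

Lemma copy_le s n (i j : 'I_n.+1) : (i <= j)%N -> (copy_fun s i <= copy_fun s j)%N.
Proof. by case: s => //=; rewrite leq_add2l. Qed.

Definition copy s n : mono n (n + n.+1) := Mono (@copy_le s n).

Lemma copy_inj s n : injective (copy s n).
Proof.
by case: s; [apply: (@rshift_inj n.+1 n.+1) | apply: (@lshift_inj n.+1 n.+1)].
Qed.

Lemma copy_disjoint s t n i j : copy s n i = copy t n j -> s = t.
Proof.
move=> /(congr1 val); have := ltn_ord i; have := ltn_ord j.
by case: s; case: t => //=; lia.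
Qed.

Variant copy_spec n : 'I_(n + n.+1).+1 -> Type :=
  CopySpec s j : copy_spec (copy s n j).

Lemma copyP n (i : 'I_(n + n.+1).+1) : copy_spec i.
Proof.
case: (@split_ordP n.+1 n.+1 i) => j ->; first exact: (CopySpec false).
exact: (CopySpec true).
Qed.

Definition mono_dbl_fun m n (a : 'I_m.+1 -> 'I_n.+1) (i : 'I_(m + m.+1).+1) :
    'I_(n + n.+1).+1 :=
  match @split m.+1 m.+1 i with
  | inl j => copy_fun false (a j)
  | inr j => copy_fun true (a j)
  end.

Lemma mono_dbl_le m n (a : mono m n) (i j : 'I_(m + m.+1).+1) :
  (i <= j)%N -> (mono_dbl_fun a i <= mono_dbl_fun a j)%N.
Proof.
rewrite /mono_dbl_fun; case: (@split_ordP m.+1 m.+1 i) => k ->;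
  case: (@split_ordP m.+1 m.+1 j) => l -> /=.
- exact: mfun_le.
- by have := ltn_ord (a k); lia.
- by have := ltn_ord l; lia.
- by rewrite !leq_add2l; apply: mfun_le.
Qed.

Definition mono_dbl m n (a : mono m n) : mono (m + m.+1) (n + n.+1) :=
  Mono (@mono_dbl_le m n a).

Lemma mono_dbl_copyE s m n (a : mono m n) j :
  mono_dbl a (copy s m j) = copy s n (a j).
Proof.
rewrite /= /mono_dbl_fun.
by case: s; rewrite ?(unsplitK (inl _)) ?(unsplitK (inr _)).
Qed.

Lemma mono_dbl_copy s m n (a : mono m n) :
  mono_comp (mono_dbl a) (copy s m) = mono_comp (copy s n) a.
Proof. by apply: mono_eq => i; apply: mono_dbl_copyE. Qed.

Lemma mono_dbl_id n : mono_dbl (mono_id n) = mono_id (n + n.+1).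
Proof. by apply: mono_eq => i; case: (copyP i) => s j; apply: mono_dbl_copyE. Qed.

Lemma mono_dbl_comp m n q (b : mono n q) (a : mono m n) :
  mono_dbl (mono_comp b a) = mono_comp (mono_dbl b) (mono_dbl a).
Proof.
apply: mono_eq => i; case: (copyP i) => s j.
rewrite mono_dbl_copyE; transitivity (mono_dbl b (copy s n (a j))).
  by rewrite mono_dbl_copyE.
by rewrite -(mono_dbl_copyE s a).
Qed.

Lemma mono_dbl_inj m n (a : mono m n) : injective a -> injective (mono_dbl a).
Proof.
move=> a_inj i j; case: (copyP i) => s k; case: (copyP j) => t l.
rewrite !mono_dbl_copyE => e; have st := copy_disjoint e; subst t.
by have /a_inj -> := copy_inj e.
Qed.

Section DoubleObject.
Variables (K : algCat) (Y : sobj K).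

Lemma dbl_act1 n : sact Y (mono_dbl (mono_id n)) = idm (Y (n + n.+1)).
Proof. by rewrite mono_dbl_id sact1. Qed.

Lemma dbl_actM m n q (b : mono n q) (a : mono m n) :
  sact Y (mono_dbl (mono_comp b a)) = sact Y (mono_dbl a) \oc sact Y (mono_dbl b).
Proof. by rewrite mono_dbl_comp sactM. Qed.

Definition dbl : sobj K :=
  @SObj K (fun n => Y (n + n.+1)) (fun m n a => sact Y (mono_dbl a)) dbl_act1 dbl_actM.

Lemma dbl_end_nat s m n (a : mono m n) :
  sact Y (copy s m) \oc sact dbl a = sact Y a \oc sact Y (copy s n).
Proof. by rewrite /= -!sactM mono_dbl_copy. Qed.

Definition dbl_end s : smap dbl Y := SMap (@dbl_end_nat s).

(** A map from [C] to the doubling of [Y] restricts along the maps from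
    [Delta n x Delta 1] to the join that are the identity on one end and on the
    other: it induces a simplicial homotopy between its two ends. *)
Definition homotopic (C : sobj K) (f g : forall n, Mor (C n) (Y n)) : Prop :=
  exists h : smap C dbl, forall n,
    dbl_end false n \oc h n = f n /\ dbl_end true n \oc h n = g n.

End DoubleObject.

(** Doubling preserves the intersection of two faces: the doublings of the i-th
    and of the j-th face meet in the doubling of the face that misses both [i]
    and [j]. *)
Lemma dbl_faces_meet q n (i j : 'I_n.+2) (a b : mono q (n + n.+1)) :
  mono_comp (mono_dbl (coface i)) a = mono_comp (mono_dbl (coface j)) b ->
  exists r (a' b' : mono r n) (c : mono q (r + r.+1)),
    [/\ mono_comp (coface i) a' = mono_comp (coface j) b',
        a = mono_comp (mono_dbl a') c & b = mono_comp (mono_dbl b') c].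
Proof.
have dinj m k := mono_dbl_inj (@coface_inj m k).
have [->|ij] := eqVneq i j.
  move=> /(mono_comp_inj (dinj _ _)) ->.
  exists n, (mono_id n), (mono_id n), b.
  by rewrite mono_dbl_id; split=> //; apply: mono_eq.
move=> e; have [j' ej|ej] := unliftP i j; last by rewrite ej eqxx in ij.
have [i' ei|ei] := unliftP j i; last by rewrite ei eqxx in ij.
have aj k : exists2 l, l != j' & exists s, a k = copy s n l.
  have ek : mono_dbl (coface i) (a k) = mono_dbl (coface j) (b k).
    exact: (congr1 (fun f : mono _ _ => f k) e).
  move: ek; case: (copyP (a k)) => s l; case: (copyP (b k)) => t m.
  rewrite !mono_dbl_copyE => elm; exists l; last by exists s.
  apply/eqP => lj; move: elm; rewrite lj => elm; have st := copy_disjoint elm.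
  subst t; have /= h := copy_inj elm.
  by have := neq_lift j m; rewrite -h -ej eqxx.
case: n i j a b ij e dinj j' ej i' ei aj => [|n] i j a b ij e dinj j' ej i' ei aj.
  by have [l] := aj ord0; rewrite !ord1 eqxx.
have [c ac] : exists c, a = mono_comp (mono_dbl (coface j')) c.
  apply: mono_factor (dinj _ _) _ => k; have [l lj [s ->]] := aj k.
  have [m ->|em] := unliftP j' l; last by rewrite em eqxx in lj.
  by exists (copy s n m); rewrite mono_dbl_copyE.
have faces : mono_comp (coface i) (coface j') = mono_comp (coface j) (coface i').
  apply: mono_eq => k; apply: ord_inj; move: ij.
  have /= vi := congr1 val ei; have /= vj := congr1 val ej.
  by rewrite /= -val_eqE /=; move: vi vj; rewrite /bump; lia.
exists n, (coface j'), (coface i'), c; split=> //.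
apply: mono_comp_inj (dinj _ j) _.
by rewrite -e ac -!mono_compA -!mono_dbl_comp faces.
Qed.

(** The family [y] on the doublings of some faces and the pair [z] on the two
    copies of the simplex agree wherever these meet, so they extend to the double
    of the simplex. A doubled face meets a copy in the copy of that face. *)
Lemma dbl_extension (K : algCat) (X : K) (Y : sover X) :
  weak_equivalence (saug Y) ->
  forall n (I : pred 'I_n.+2) (y : 'I_n.+2 -> und (dbl Y n))
    (z : bool -> und (Y n.+1)),
  agree_on_overlaps I y ->
  (forall s t, undm (sproj Y n.+1) (z s) = undm (sproj Y n.+1) (z t)) ->
  (forall s i, I i -> act Y (coface i) (z s) = act Y (copy s n) (y i)) ->
  exists x : und (dbl Y n.+1),
    (forall i, I i -> act (dbl Y) (coface i) x = y i) /\
    (forall s, act Y (copy s n.+1) x = z s).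
Proof.
move=> acyclicY n I y z yy zz yz.
pose d (t : {i | I i} + bool) := if t is inl _ then (n + n.+1)%N else n.+1.
pose g t : mono (d t) (n.+1 + n.+2) :=
  match t with inl i => mono_dbl (coface (sval i)) | inr s => copy s n.+1 end.
pose v t : und (Y (d t)) := match t with inl i => y (sval i) | inr s => z s end.
have meet s i (Ii : I i) q (a : mono q (n + n.+1)) (b : mono q n.+1) :
    mono_comp (mono_dbl (coface i)) a = mono_comp (copy s n.+1) b ->
    act Y a (y i) = act Y b (z s).
  move=> e; have [c ec] : exists c, b = mono_comp (coface i) c.
    apply: coface_factor => k; apply/eqP => bk.
    have : mono_dbl (coface i) (a k) = copy s n.+1 i.
      transitivity (copy s n.+1 (b k)); last by rewrite bk.
      exact: (congr1 (fun f : mono _ _ => f k) e).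
    case: (copyP (a k)) => t l; rewrite mono_dbl_copyE => il.
    have st := copy_disjoint il; subst t; have /= li := copy_inj il.
    by have := neq_lift i l; rewrite li eqxx.
  have -> : a = mono_comp (copy s n) c.
    apply: mono_comp_inj (mono_dbl_inj (@coface_inj _ i)) _.
    by rewrite e ec -!mono_compA mono_dbl_copy.
  by rewrite ec !act_comp yz.
have [|x [_ xv]] := simplex_extension acyclicY (g := g) (y := v)
  (x := undm (sproj Y n.+1) (z true)).
  split=> [[[i Ii]|s]|[[i Ii]|s] [[j Ij]|t] q a b /= e].
  - by rewrite -(aug_act (copy true n)) -yz // aug_act.
  - exact: zz.
  - have [r [a' [b' [c [faces -> ->]]]]] := dbl_faces_meet e.
    rewrite !act_comp; congr (act Y c _); exact: yy faces.
  - exact: meet.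
  - exact/esym/meet.
  - have st : s = t.
      by apply: copy_disjoint (congr1 (fun f : mono _ _ => f ord0) e).
    by rewrite st in e *; rewrite (mono_comp_inj (@copy_inj _ _) e).
exists x; split=> [i Ii|s]; last exact: (xv (inr s)).
exact: (xv (inl (exist _ i Ii))).
Qed.

(** * Fibre products of augmented algebras *)

Section FibreProduct.
Variables (F : fieldType) (A X : augAlg F) (f : augHom A X).

Definition agreeing : {pred (A * A)%type} := [pred x | f x.1 == f x.2].

Lemma agreeing_subalg : GRing.subalg_closed agreeing.
Proof.
split=> [|c x y|x y]; rewrite !inE /=.
- by rewrite !rmorph1.
- by move=> /eqP ex /eqP ey; rewrite !linearP /= ex ey.
- by move=> /eqP ex /eqP ey; rewrite !rmorphM /= ex ey.
Qed.

HB.instance Definition _ := GRing.isSubalgClosed.Build F (A * A)%type agreeing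
  (GRing.subalg_closed_semi agreeing_subalg).

Record fibre_pair := FibrePair {
  fpval :> (A * A)%type; _ : fpval \in agreeing }.

HB.instance Definition _ := [isSub for fpval].
HB.instance Definition _ := [Choice of fibre_pair by <:].
HB.instance Definition _ := [SubChoice_isSubComNzRing of fibre_pair by <:].
HB.instance Definition _ := [SubNmodule_isSubLSemiModule of fibre_pair by <:].
HB.instance Definition _ :=
  GRing.SubNzRing_SubLmodule_isSubLalgebra.Build F (A * A)%type agreeing fibre_pair.
HB.instance Definition _ := GRing.Lalgebra_isComAlgebra.Build F fibre_pair.

Definition fibre_aug (x : fibre_pair) : F := aug A (val x).1.

Lemma fibre_aug_lin : linear_for *%R fibre_aug.
Proof. by move=> c x y; rewrite /fibre_aug linearP. Qed.

Lemma fibre_aug_mul : monoid_morphism fibre_aug.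
Proof. by split=> [|x y]; rewrite /fibre_aug ?rmorph1 ?rmorphM. Qed.

HB.instance Definition _ :=
  GRing.isLinear.Build F fibre_pair F *%R fibre_aug fibre_aug_lin.
HB.instance Definition _ :=
  GRing.isMonoidMorphism.Build fibre_pair F fibre_aug fibre_aug_mul.

Definition fibre_alg : augAlg F := @AugAlg F fibre_pair fibre_aug.

Definition fibre_fst : augHom fibre_alg A :=
  @AugHom F fibre_alg A (fun x => (val x).1) (fun _ _ _ => erefl)
    (conj erefl (fun _ _ => erefl)) (fun _ => erefl).

Lemma fibreE (x : fibre_alg) : f (val x).1 = f (val x).2.
Proof. exact/eqP/(valP x). Qed.

Definition fibre_snd : augHom fibre_alg A.
Proof.
exists (fun x => (val x).2) => //.
by move=> x; rewrite -(ahom_aug f) -fibreE ahom_aug.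
Defined.

Section FibreMap.
Variables (T : augAlg F) (u v : augHom T A).
Hypothesis uv : aug_comp f u = aug_comp f v.

Lemma fibre_map_in x : (u x, v x) \in agreeing.
Proof. exact/eqP/(congr1 (fun h : augHom T X => h x) uv). Qed.

Definition fibre_map_fun (x : T) : fibre_alg := FibrePair (fibre_map_in x).

Lemma fibre_map_lin : linear fibre_map_fun.
Proof. by move=> c x y; apply: val_inj; rewrite /= !linearP. Qed.

Lemma fibre_map_mul : monoid_morphism fibre_map_fun.
Proof.
by split=> [|x y]; apply: val_inj; rewrite /= ?rmorph1 ?rmorphM.
Qed.

Definition fibre_map : augHom T fibre_alg :=
  @AugHom F T fibre_alg fibre_map_fun fibre_map_lin fibre_map_mul
    (fun x => ahom_aug u x).

End FibreMap.

End FibreProduct.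

Section SimplicialFibreProduct.
Variables (F : fieldType) (X : ComAug F) (Y : sover X).

Local Notation proj n := (sproj Y n : augHom (Y n) X).

Lemma fibre_act_over m n (a : mono m n) :
  aug_comp (proj m) (aug_comp (sact Y a) (fibre_fst (proj n))) =
  aug_comp (proj m) (aug_comp (sact Y a) (fibre_snd (proj n))).
Proof.
rewrite !aug_compA (sproj_nat Y a : aug_comp (proj m) _ = _).
by apply: augHom_eq => x; apply: fibreE.
Qed.

Definition fibre_act m n (a : mono m n) := fibre_map (fibre_act_over a).

Lemma fibre_act1 n : fibre_act (mono_id n) = aug_id (fibre_alg (proj n)).
Proof.
apply: augHom_eq => x; apply: val_inj; rewrite /= [sact Y _]sact1.
by case: x => -[].
Qed.

Lemma fibre_actM m n q (b : mono n q) (a : mono m n) :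
  fibre_act (mono_comp b a) = aug_comp (fibre_act a) (fibre_act b).
Proof. by apply: augHom_eq => x; apply: val_inj; rewrite /= [sact Y _]sactM. Qed.

Definition fibre_square : sobj (ComAug F) :=
  @SObj (ComAug F) (fun n => fibre_alg (proj n)) fibre_act fibre_act1 fibre_actM.

Section Pair.
Variables (C : sobj (ComAug F)) (f g : smap C Y).
Hypothesis fg : forall n, sproj Y n \oc f n = sproj Y n \oc g n.

Lemma fibre_pair_nat m n (a : mono m n) :
  aug_comp (fibre_map (fg m)) (sact C a) = aug_comp (fibre_act a) (fibre_map (fg n)).
Proof.
apply: augHom_eq => x; apply: val_inj => /=.
have nat (h : smap C Y) : (h m : augHom _ _) ((sact C a : augHom _ _) x) =
    (sact Y a : augHom _ _) ((h n : augHom _ _) x).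
  exact: (congr1 (fun u : augHom (C n) (Y m) => u x) (smap_nat h a)).
by rewrite !nat.
Qed.

Definition fibre_smap : smap C fibre_square :=
  @SMap (ComAug F) C fibre_square (fun n => fibre_map (fg n)) fibre_pair_nat.

End Pair.

Lemma dbl_over n : sproj Y n \oc dbl_end Y false n = sproj Y n \oc dbl_end Y true n.
Proof.
exact: etrans (sproj_nat Y (copy false n)) (esym (sproj_nat Y (copy true n))).
Qed.

Definition ends : smap (dbl Y) fibre_square := fibre_smap dbl_over.

Hypothesis acyclicY : weak_equivalence (saug Y).

(** Filling faces for this map amounts to extending to the double of a simplex a
    map that is given on both copies of the simplex and on doubled faces. *)
Lemma ends_trivial_fibration : trivial_fibration ends.
Proof.
apply: fills_faces_trivial_fibration => n I y z yy yz.
have zE i (Ii : I i) := congr1 (fun u : fibre_alg (proj n) => val u) (yz i Ii).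
have [||x [xy xz]] :=
  dbl_extension acyclicY (z := fun s : bool => if s then (val z).2 else (val z).1) yy.
- have e : undm (sproj Y n.+1) (val z).1 = undm (sproj Y n.+1) (val z).2.
    exact: fibreE z.
  by case; case.
- by move=> s i Ii; have [] := zE i Ii; case: s.
- exists x; split=> //; apply: val_inj.
  rewrite [RHS]surjective_pairing.
  by congr pair; [apply: (xz false) | apply: (xz true)].
Qed.

(** A lift of the pair to the doubling is a homotopy. *)
Lemma cofibrant_homotopic (C : sobj (ComAug F)) (f g : smap C Y) : cofibrant C ->
  (forall n, sproj Y n \oc f n = sproj Y n \oc g n) -> homotopic f g.
Proof.
move=> cofC fg; have [h hfg] := cofC _ _ _ ends_trivial_fibration (fibre_smap fg).
exists h => n; have e := congr1 (fun u : smap C fibre_square => u n) hfg.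
have e' x := congr1 (fun u : augHom (C n) (fibre_alg (proj n)) => val (u x)) e.
by split; apply: augHom_eq => x; have [] := e' x.
Qed.

End SimplicialFibreProduct.
(** * The prism operator *)

Lemma prism_subproof n k (j : 'I_n.+2) :
  ((if (j <= k)%N then (j : nat) else (n + j)%N) < (n + n.+1).+1)%N.
Proof. by have := ltn_ord j; case: ifP; lia. Qed.

Lemma prism_le n k (i j : 'I_n.+2) : (i <= j)%N ->
  (Ordinal (prism_subproof k i) <= Ordinal (prism_subproof k j))%N.
Proof. by move=> /= ij; have := ltn_ord i; do 2!case: ifP; lia. Qed.

(** The k-th maximal simplex of the prism: the vertices [0, ..., k] of the first
    copy of the n-simplex, then [k, ..., n] of the second one. *)
Definition prism n k : mono n.+1 (n + n.+1) := Mono (@prism_le n k).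

Lemma wall_subproof n k (j : 'I_n.+1) :
  ((if (j < k)%N then (j : nat) else (n.+1 + j)%N) < (n + n.+1).+1)%N.
Proof. by have := ltn_ord j; case: ifP; lia. Qed.

Lemma wall_le n k (i j : 'I_n.+1) : (i <= j)%N ->
  (Ordinal (wall_subproof k i) <= Ordinal (wall_subproof k j))%N.
Proof. by move=> /= ij; have := ltn_ord i; do 2!case: ifP; lia. Qed.

(** What separates two maximal simplices: the vertices [0, ..., k - 1] of the first
    copy, then [k, ..., n] of the second one. *)
Definition wall n k : mono n (n + n.+1) := Mono (@wall_le n k).

Lemma wall0 n : wall n 0 = copy true n.
Proof. by apply: mono_eq => i; apply: val_inj. Qed.

Lemma wall_max n : wall n n.+1 = copy false n.
Proof. by apply: mono_eq => i; apply: val_inj; rewrite /= ltn_ord. Qed.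

Lemma prism_wall n k (i : 'I_n.+2) : (i == k :> nat) || (i == k.+1 :> nat) ->
  mono_comp (prism n k) (coface i) = wall n i.
Proof.
move=> ik; apply: mono_eq => j; apply: val_inj; move: ik.
by rewrite /= /bump; do 2!case: ifP; lia.
Qed.

Lemma prismE n k (i : 'I_n.+2) : (k <= n)%N ->
  prism n k i = copy (k < i)%N n (inord (i - (k < i))).
Proof.
move=> kn; apply: ord_inj; have := ltn_ord i; rewrite /= /copy_fun.
by case: (ltnP k i) => ki /= hi; rewrite inordK //; lia.
Qed.

(** A face of a prism simplex that is not a wall is a simplex of the prism on a
    face. *)
Lemma prism_face_lt n k (j : 'I_n.+2) (i : 'I_n.+3) :
  (k <= n)%N -> (j <= k)%N -> i = j :> nat ->
  mono_comp (prism n.+1 k.+1) (coface i) =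
  mono_comp (mono_dbl (coface j)) (prism n k).
Proof.
move=> kn jk ij; apply: mono_eq => x.
transitivity (mono_dbl (coface j) (prism n k x)) => //.
rewrite prismE // mono_dbl_copyE; apply: ord_inj; have := ltn_ord x.
rewrite /= /copy_fun /=; case: (ltnP k x) => kx /= hx.
  by rewrite ij inordK /bump; repeat case: ifP; lia.
by rewrite ij inordK /bump; repeat case: ifP; lia.
Qed.

Lemma prism_face_gt n k (j : 'I_n.+2) (i : 'I_n.+3) :
  (k <= n)%N -> (k < j)%N -> i = j.+1 :> nat ->
  mono_comp (prism n.+1 k) (coface i) =
  mono_comp (mono_dbl (coface j)) (prism n k).
Proof.
move=> kn jk ij; apply: mono_eq => x.
transitivity (mono_dbl (coface j) (prism n k x)) => //.
rewrite prismE // mono_dbl_copyE; apply: ord_inj; have := ltn_ord x.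
rewrite /= /copy_fun /=; case: (ltnP k x) => kx /= hx.
  by rewrite ij inordK /bump; repeat case: ifP; lia.
by rewrite ij inordK /bump; repeat case: ifP; lia.
Qed.

(** Prism decomposition. [A k l] stands for the l-th face of the k-th simplex of
    the prism, [t k] for the k-th wall and [B k l] for the k-th simplex of the prism
    on the l-th face. The walls inside the prism are faces of two simplices with
    opposite signs, so only the two ends are left besides the terms [B k l]. *)
Lemma prism_sum (G : zmodType) (N : nat) (A B : nat -> nat -> G) (t : nat -> G) :
  (forall k, (k <= N)%N -> A k k = t k) ->
  (forall k, (k <= N)%N -> A k k.+1 = t k.+1) ->
  (forall k l, (k < N)%N -> (l <= k)%N -> A k.+1 l = B k l) ->
  (forall k l, (l <= N)%N -> (k < l)%N -> A k l.+1 = B k l) ->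
  \sum_(k < N.+1) \sum_(l < N.+2) A k l *~ ((-1) ^+ k * (-1) ^+ l) =
  t 0%N - t N.+1 -
  \sum_(k < N) \sum_(l < N.+1) B k l *~ ((-1) ^+ k * (-1) ^+ l).
Proof.
elim: N => [|N IH] Akk Ak1 Alt Agt.
  rewrite !big_ord_recr !big_ord0 /= !add0r Akk // Ak1 // subr0.
  by rewrite expr0 expr1 !mul1r mulr1z mulrN1z.
have sNN k : (-1) ^+ k * (-1) ^+ k.+1 = -1 :> int.
  by rewrite exprS mulN1r mulrN -expr2 sqrr_sign.
pose P := \sum_(k < N.+1) A k N.+2 *~ ((-1) ^+ k * (-1) ^+ N.+2).
pose Q := \sum_(l < N.+1) A N.+1 l *~ ((-1) ^+ N.+1 * (-1) ^+ l).
have -> : \sum_(k < N.+1) \sum_(l < N.+2) B k l *~ ((-1) ^+ k * (-1) ^+ l) =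
    \sum_(k < N) \sum_(l < N.+1) B k l *~ ((-1) ^+ k * (-1) ^+ l) - P - Q.
  have -> : P = - \sum_(k < N.+1) B k N.+1 *~ ((-1) ^+ k * (-1) ^+ N.+1).
    rewrite -sumrN; apply: eq_bigr => k _; have kN := ltn_ord k.
    by rewrite Agt // exprS mulN1r mulrN mulrNz.
  have -> : Q = - \sum_(l < N.+1) B N l *~ ((-1) ^+ N * (-1) ^+ l).
    rewrite -sumrN; apply: eq_bigr => l _; have lN := ltn_ord l.
    by rewrite Alt // exprS mulN1r mulNr mulrNz.
  rewrite !opprK big_ord_recr /= [X in _ + X]big_ord_recr /=.
  under eq_bigr => k _ do rewrite big_ord_recr /=.
  rewrite big_split /= [in RHS]big_ord_recr /= !addrA.
  by rewrite [LHS]addrAC.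
rewrite big_ord_recr /= [X in _ + X]big_ord_recr /= [X in _ + (X + _)]big_ord_recr /=.
under eq_bigr => k _ do rewrite big_ord_recr /=.
rewrite big_split /= IH; first 1 last.
- by move=> k kN; apply: Akk; lia.
- by move=> k kN; apply: Ak1; lia.
- by move=> k l kN lk; apply: Alt; lia.
- by move=> k l lN kl; apply: Agt; lia.
rewrite Akk // Ak1 // sNN -expr2 sqrr_sign mulr1z mulrN1z -/P -/Q.
by rewrite !opprB !addrA [LHS](ACl (1*7*5*4*3*(2*6))) /= addNr addr0.
Qed.

(** * Homotopy invariance *)

Lemma cohomotopy_mapE (G H : cosimp) (f : cmap G H) n (z : cocycle G n) :
  cohomotopy_map f n (\pi_(cohomotopy G n)%qT z) =
  \pi_(cohomotopy H n)%qT (cocyc_map f z).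
Proof. exact: cohomotopy_funE. Qed.

Lemma cohomotopy_map_eq (G H : cosimp) (f g : cmap G H) n :
  (forall z : G n, cdiff z = 0 -> coboundary (f n z - g n z)) ->
  cohomotopy_map f n =1 cohomotopy_map g n.
Proof.
move=> fg x; rewrite -[x]reprK !cohomotopy_mapE.
apply/eqP; rewrite -Quotient.idealrBE inE; apply/asboolP.
rewrite raddfB; apply: (fg (\val (repr x))); apply/eqP.
exact: (valP (repr x)).
Qed.

Lemma cohomotopy_map_comp (G H J : cosimp) (g : cmap H J) (f : cmap G H) n x :
  cohomotopy_map (ccomp g f) n x = cohomotopy_map g n (cohomotopy_map f n x).
Proof.
rewrite -[x]reprK [cohomotopy_map f n _]cohomotopy_mapE !cohomotopy_mapE.
by congr (\pi_(cohomotopy J n)%qT _); apply: val_inj.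
Qed.

Section Homotopy.
Variables (K : algCat) (X : K) (E : beck X) (C Y : sover X).
Variables (f g : overMap C Y) (h : smap C (dbl Y)).
Hypothesis hf : forall n, dbl_end Y false n \oc h n = f n.
Hypothesis hg : forall n, dbl_end Y true n \oc h n = g n.

(** All simplices of the prism lie over the same point of [X], that of an end. *)
Lemma homotopy_over q n (a : mono q (n + n.+1)) :
  sproj Y q \oc (sact Y a \oc h n) = sproj C n.
Proof.
rewrite compmA sproj_nat -(om_over f) -hf compmA.
by rewrite [sproj Y n \oc _](sproj_nat Y (copy false n)).
Qed.

Definition homotopy_pull q n (a : mono q (n + n.+1)) :
    {additive der E Y q -> der E C n} :=
  bpull (homotopy_over a).

Local Notation R := homotopy_pull.

Lemma homotopy_pull_der q r n (a : mono q (n + n.+1)) (b : mono r q) x :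
  R a (cact (der E Y) b x) = R (mono_comp a b) x.
Proof. by apply: slice_eq; rewrite /= sactM !compmA. Qed.

Lemma der_homotopy_pull q m n (c : mono m n) (a : mono q (m + m.+1)) x :
  cact (der E C) c (R a x) = R (mono_comp (mono_dbl c) a) x.
Proof.
by apply: slice_eq; rewrite /= sactM -!compmA (smap_nat h c).
Qed.

Lemma homotopy_pull_ends n x :
  R (copy false n) x = der_pre E f n x /\ R (copy true n) x = der_pre E g n x.
Proof. by split; apply: slice_eq; rewrite /= -?hf -?hg. Qed.

(** The cochain homotopy is the alternating sum over the simplices of the prism. *)
Lemma homotopy_coboundary n (x : der E Y n) : cdiff x = 0 ->
  coboundary (der_pre E g n x - der_pre E f n x).
Proof.
move=> dx; have [<- <-] := homotopy_pull_ends x.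
rewrite -wall0 -wall_max.
pose A k l := R (mono_comp (prism n k) (coface (inord l : 'I_n.+2))) x.
have A0 : \sum_(k < n.+1) \sum_(l < n.+2) A k l *~ ((-1) ^+ k * (-1) ^+ l) = 0.
  apply: big1 => k _; transitivity (R (prism n k) (cdiff x) *~ (-1) ^+ k).
    rewrite /cdiff raddf_sum mulrz_suml; apply: eq_bigr => l _.
    by rewrite raddfMz homotopy_pull_der /A inord_val mulrC mulrzA.
  by rewrite dx raddf0 mul0rz.
have Ak k : (k <= n)%N -> A k k = R (wall n k) x.
  move=> kn; have ek : (inord k : 'I_n.+2) = k :> nat by rewrite inordK //; lia.
  by rewrite /A prism_wall ek ?eqxx.
have Ak1 k : (k <= n)%N -> A k k.+1 = R (wall n k.+1) x.
  move=> kn; have ek : (inord k.+1 : 'I_n.+2) = k.+1 :> nat by rewrite inordK.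
  by rewrite /A prism_wall ek ?eqxx ?orbT.
case: n x dx @A A0 Ak Ak1 => [|n] x dx A A0 Ak Ak1.
  have := @prism_sum _ 0 A A (fun k => R (wall 0 k) x) Ak Ak1.
  rewrite A0 big_ord0 subr0 => /(_ (fun _ _ => _))/= <- //.
  by move=> k l; rewrite leqn0 => /eqP ->.
pose B k l := R (mono_comp (mono_dbl (coface (inord l : 'I_n.+2))) (prism n k)) x.
have := @prism_sum _ n.+1 A B (fun k => R (wall n.+1 k) x) Ak Ak1.
rewrite A0 => /(_ _ _)/esym/eqP; rewrite subr_eq0 => BE.
exists (\sum_(k < n.+1) R (prism n k) x *~ (-1) ^+ k).
rewrite (eqP (BE _ _)).
- rewrite raddf_sum; apply: eq_bigr => k _.
  rewrite raddfMz /= /cdiff mulrz_suml; apply: eq_bigr => l _.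
  by rewrite der_homotopy_pull /B inord_val mulrC mulrzA.
- move=> k l kn lk; rewrite /A /B (prism_face_lt (j := inord l)) // ?inordK //; lia.
- move=> k l ln kl; rewrite /A /B (prism_face_gt (j := inord l)) // ?inordK //; lia.
Qed.

End Homotopy.

Lemma homotopic_cohomotopy (K : algCat) (X : K) (E : beck X) (C Y : sover X)
    (f g : overMap C Y) n :
  homotopic f g ->
  cohomotopy_map (der_pre E f) n =1 cohomotopy_map (der_pre E g) n.
Proof.
case=> h hfg; apply/fsym; apply: cohomotopy_map_eq => x dx.
by apply: (homotopy_coboundary (h := h)) => // m; have [] := hfg m.
Qed.

Lemma coboundary0 (G : cosimp) n : coboundary (0 : G n).
Proof. by case: n => [|n] //=; exists 0; rewrite raddf0. Qed.

Lemma cohomotopy_map_ext (G H : cosimp) (f g : cmap G H) n :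
  f n =1 g n -> cohomotopy_map f n =1 cohomotopy_map g n.
Proof.
move=> fg; apply: cohomotopy_map_eq => z _.
by rewrite fg subrr; apply: coboundary0.
Qed.

(** * Composition over an object *)

Section OverComp.
Variables (K : algCat) (X : K) (C D E : sover X).
Variables (g : overMap D E) (f : overMap C D).

Lemma overcomp_over n : sproj E n \oc scomp g f n = sproj C n.
Proof. by rewrite /= compmA !om_over. Qed.

Definition overcomp : overMap C E := OverMap overcomp_over.

End OverComp.

Section FunctorOver.
Variables (K K' : algCat) (T : functor K K') (X : K) (C D : sover X).
Variable f : overMap C D.

Lemma sfun_map_nat m n (a : mono m n) :
  fmor T (f m) \oc sact (sfun T C) a = sact (sfun T D) a \oc fmor T (f n).
Proof. by rewrite /= -!fmorM smap_nat. Qed.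

Lemma sfun_map_over n : sproj (sfun T D) n \oc fmor T (f n) = sproj (sfun T C) n.
Proof. by rewrite /= -fmorM om_over. Qed.

Definition sfun_map : overMap (sfun T C) (sfun T D) :=
  @OverMap K' (T X) (sfun T C) (sfun T D)
    (@SMap K' (sfun T C) (sfun T D) (fun n => fmor T (f n)) sfun_map_nat)
    sfun_map_over.

End FunctorOver.

(** * Lifting and transposition *)

Lemma cofibrant_lift (K : algCat) (X : K) (Y : sover X) (C : sobj K)
    (u : forall n, Mor (C n) X) :
  weak_equivalence (saug Y) -> cofibrant C ->
  (forall m n (a : mono m n), u m \oc sact C a = u n) ->
  exists f : smap C Y, forall n, sproj Y n \oc f n = u n.
Proof.
move=> acyclicY cofC u_nat.
have u_nat' m n (a : mono m n) : u m \oc sact C a = sact (sconst X) a \oc u n.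
  by rewrite u_nat comp1m.
have [|f fu] := cofC _ _ (saug Y) _ (@SMap K C (sconst X) u u_nat').
  exact/fills_faces_trivial_fibration/acyclic_fills_faces.
by exists f => n; apply: (congr1 (fun h : smap C (sconst X) => h n) fu).
Qed.

Section Adjunction.
Variables (K K' : algCat) (U : functor K' K) (L : left_adjoint U).

Lemma adj_inj (A : K) (B : K') (g h : Mor (L A) B) :
  fmor U g \oc adj_unit L A = fmor U h \oc adj_unit L A -> g = h.
Proof.
by move=> e; have [k [_ kP]] := adj_univ L (fmor U h \oc adj_unit L A);
  rewrite -(kP g e) -(kP h erefl).
Qed.

(** Naturality of the transposed family follows from uniqueness of transposes. *)
Lemma smap_transpose (X : K) (C : sover X) (D : sobj K')
    (s : forall n, Mor (C n) (U (D n))) :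
  (forall m n (a : mono m n), s m \oc sact C a = fmor U (sact D a) \oc s n) ->
  exists t : smap (sfun L C) D, forall n, fmor U (t n) \oc adj_unit L (C n) = s n.
Proof.
move=> s_nat; pose t n := sval (cid (adj_univ L (s n))).
have tE n : fmor U (t n) \oc adj_unit L (C n) = s n.
  by rewrite /t; case: cid => g [].
have t_nat m n (a : mono m n) : t m \oc sact (sfun L C) a = sact D a \oc t n.
  apply: adj_inj; rewrite /= !fmorM -compmA -adj_unit_nat compmA tE s_nat.
  by rewrite -compmA tE.
by exists (SMap t_nat).
Qed.

End Adjunction.

(** * The comparison maps *)

Section EnvelopeComparison.
Variables (F : fieldType) (p : nat) (charF : p \in [pchar F]).
Variables (L : left_adjoint (forget F p)) (A : augAlg F).
Local Notation U := (forget F p).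

Section Replacements.
Variables (D : @cofrep (PCom F p) (L A)) (C : @cofrep (ComAug F) A).

Lemma forget_acyclic : weak_equivalence (saug (sfun U D)).
Proof. exact: (cofr_weq D). Qed.

Lemma comparison1_exists : inhabited (overMap (sfun L C) D).
Proof.
have [|f fE] := cofibrant_lift (u := fun n => adj_unit L A \oc sproj C n)
  forget_acyclic (@cofr_cofibrant _ _ C).
  by move=> m n a; rewrite -compmA sproj_nat.
have [|t tE] := smap_transpose L (C := C) (D := D) (s := f).
  by move=> m n a; exact: (smap_nat f a).
suff t_over n : sproj D n \oc t n = sproj (sfun L C) n by exists; exists t.
apply: adj_inj; rewrite fmorM -compmA tE [LHS]fE.
exact: adj_unit_nat.
Qed.

(** The homotopy is found between the transposes [C -> U D], and is itself
    transposed to [L C -> dbl D]. *)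
Lemma overMap_homotopic (phi psi : overMap (sfun L C) D) : homotopic phi psi.
Proof.
have adj_nat (f : overMap (sfun L C) D) m n (a : mono m n) :
    (fmor U (f m) \oc adj_unit L (C m)) \oc sact C a =
    fmor U (sact D a) \oc (fmor U (f n) \oc adj_unit L (C n)).
  rewrite -compmA adj_unit_nat !compmA -!fmorM.
  by rewrite [in LHS](smap_nat f a).
pose s (f : overMap (sfun L C) D) : smap C (sfun U D) :=
  @SMap (ComAug F) C (sfun U D) _ (adj_nat f).
have [|h hE] := cofibrant_homotopic forget_acyclic (f := s phi) (g := s psi)
  (@cofr_cofibrant _ _ C).
  have over (f : overMap (sfun L C) D) n :
      fmor U (sproj D n) \oc (fmor U (f n) \oc adj_unit L (C n)) =
      adj_unit L A \oc sproj C n.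
    by rewrite compmA -fmorM om_over [RHS]adj_unit_nat.
  by move=> n; rewrite /= [LHS]over [RHS]over.
have [|t tE] := smap_transpose L (C := C) (D := dbl D) (s := h).
  by move=> m n a; exact: (smap_nat h a).
exists t => n; have [h0 h1] := hE n.
split; apply: adj_inj; rewrite fmorM -compmA tE.
  exact: h0.
exact: h1.
Qed.

End Replacements.

Variable M : lmodType (vring (L A : pCom F p) charF).

Lemma comparison1_indep (D : @cofrep (PCom F p) (L A)) (C : @cofrep (ComAug F) A)
    (phi psi : overMap (sfun L C) D) n :
  cohomotopy_map (comparison1 M phi) n =1 cohomotopy_map (comparison1 M psi) n.
Proof.
move=> x; rewrite !cohomotopy_map_comp; congr (cohomotopy_map _ n _).
exact/homotopic_cohomotopy/overMap_homotopic.
Qed.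

(** Both sides are induced by maps from [L C] to [D'], namely the two ways around
    the square formed by [phi], [psi], [v] and the image of [u]. *)
Lemma comparison1_nat (D D' : @cofrep (PCom F p) (L A)) (C C' : @cofrep (ComAug F) A)
    (phi : overMap (sfun L C) D) (psi : overMap (sfun L C') D')
    (v : overMap D D') (u : overMap C C') n (x : HQ (beckP M) D' n) :
  cohomotopy_map (comparison1 M phi) n (HQ_map (beckP M) v n x) =
  HQ_map (beckCom (unitMod M)) u n (cohomotopy_map (comparison1 M psi) n x).
Proof.
rewrite /HQ_map -!cohomotopy_map_comp.
transitivity (cohomotopy_map (comparison1 M (overcomp v phi)) n x).
  by apply: cohomotopy_map_ext => y; apply: cslice_eq.
rewrite (comparison1_indep _ (overcomp psi (sfun_map L u))).
apply: cohomotopy_map_ext => y; apply: cslice_eq => w.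
change (psnd y ((psi n : pHom _ _) ((fmor L (u n) : pHom _ _)
          ((adj_unit L (C n) : augHom _ (L (C n) : pCom F p)) w))) =
        psnd y ((psi n : pHom _ _)
          ((adj_unit L (C' n) : augHom _ (L (C' n) : pCom F p)) ((u n : augHom _ _) w)))).
congr (psnd y ((psi n : pHom _ _) _)).
exact: (congr1 (fun f : augHom (C n) (L (C' n) : pCom F p) => f w)
  (esym (adj_unit_nat L (u n)))).
Qed.

End EnvelopeComparison.

Section ForgetfulComparison.
Variables (F : fieldType) (p : nat) (charF : p \in [pchar F]).
Variables (B : pCom F p) (M : lmodType (vring B charF)).
Local Notation U := (forget F p).

Lemma comparison2_exists (D : @cofrep (PCom F p) B) (C : @cofrep (ComAug F) (U B)) :
  inhabited (overMap C (sfun U D)).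
Proof.
have [|f fE] := cofibrant_lift (Y := sfun U D) (u := sproj C) (cofr_weq D)
  (@cofr_cofibrant _ _ C).
  exact: sproj_nat.
by exists; exists f.
Qed.

Lemma comparison2_indep (D : @cofrep (PCom F p) B) (C : @cofrep (ComAug F) (U B))
    (phi psi : overMap C (sfun U D)) n :
  cohomotopy_map (comparison2 M phi) n =1 cohomotopy_map (comparison2 M psi) n.
Proof.
move=> x; rewrite !cohomotopy_map_comp.
apply: homotopic_cohomotopy; apply: cofibrant_homotopic.
- exact: (cofr_weq D).
- exact: (@cofr_cofibrant _ _ C).
- by move=> m; rewrite !om_over.
Qed.

Lemma comparison2_nat (D D' : @cofrep (PCom F p) B) (C C' : @cofrep (ComAug F) (U B))
    (phi : overMap C (sfun U D)) (psi : overMap C' (sfun U D'))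
    (v : overMap D D') (u : overMap C C') n (x : HQ (beckP M) D' n) :
  cohomotopy_map (comparison2 M phi) n (HQ_map (beckP M) v n x) =
  HQ_map (beckCom (thetaMod M)) u n (cohomotopy_map (comparison2 M psi) n x).
Proof.
rewrite /HQ_map -!cohomotopy_map_comp.
transitivity (cohomotopy_map (comparison2 M (overcomp (sfun_map U v) phi)) n x).
  by apply: cohomotopy_map_ext => y; apply: cslice_eq.
rewrite (comparison2_indep _ (overcomp psi u)).
by apply: cohomotopy_map_ext => y; apply: cslice_eq.
Qed.

End ForgetfulComparison.

Theorem proposition12p2 (F : fieldType) (p : nat) (charF : p \in [pchar F]) :
  (forall (L : left_adjoint (forget F p)) (A : augAlg F)
      (M : lmodType (vring (L A : pCom F p) charF)),
    exists kappa : forall (D : @cofrep (PCom F p) (L A))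
        (C : @cofrep (ComAug F) A) (n : nat),
        {additive HQ (beckP M) D n -> HQ (beckCom (unitMod M)) C n},
      [/\ forall (D : @cofrep (PCom F p) (L A)) (C : @cofrep (ComAug F) A),
            inhabited (overMap (sfun L C) D),
          forall (D : @cofrep (PCom F p) (L A)) (C : @cofrep (ComAug F) A)
              (phi : overMap (sfun L C) D) (n : nat)
              (x : HQ (beckP M) D n),
            kappa D C n x = cohomotopy_map (comparison1 M phi) n x
        & forall (D D' : @cofrep (PCom F p) (L A))
              (C C' : @cofrep (ComAug F) A)
              (v : overMap D D') (u : overMap C C') (n : nat)
              (x : HQ (beckP M) D' n),
            kappa D C n (HQ_map (beckP M) v n x) =
            HQ_map (beckCom (unitMod M)) u n (kappa D' C' n x)]) /\
  (forall (B : pCom F p) (M : lmodType (vring B charF)),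
    exists kappa : forall (D : @cofrep (PCom F p) B)
        (C : @cofrep (ComAug F) (forget F p B)) (n : nat),
        {additive HQ (beckP M) D n -> HQ (beckCom (thetaMod M)) C n},
      [/\ forall (D : @cofrep (PCom F p) B)
              (C : @cofrep (ComAug F) (forget F p B)),
            inhabited (overMap C (sfun (forget F p) D)),
          forall (D : @cofrep (PCom F p) B)
              (C : @cofrep (ComAug F) (forget F p B))
              (psi : overMap C (sfun (forget F p) D)) (n : nat)
              (x : HQ (beckP M) D n),
            kappa D C n x = cohomotopy_map (comparison2 M psi) n x
        & forall (D D' : @cofrep (PCom F p) B)
              (C C' : @cofrep (ComAug F) (forget F p B))
              (v : overMap D D') (u : overMap C C') (n : nat)
              (x : HQ (beckP M) D' n),
            kappa D C n (HQ_map (beckP M) v n x) =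
            HQ_map (beckCom (thetaMod M)) u n (kappa D' C' n x)]).
Proof.
split=> [L A M|B M].
  pose phi D C := sval (cid (let: inhabits f := @comparison1_exists F p L A D C in
    ex_intro (fun=> True) f I)).
  exists (fun D C n => cohomotopy_map (comparison1 M (phi D C)) n); split.
  - exact: comparison1_exists.
  - by move=> D C f n; apply: comparison1_indep.
  - by move=> *; apply: comparison1_nat.
pose phi D C := sval (cid (let: inhabits f := @comparison2_exists F p B D C in
  ex_intro (fun=> True) f I)).
exists (fun D C n => cohomotopy_map (comparison2 M (phi D C)) n); split.
- exact: comparison2_exists.
- by move=> D C f n; apply: comparison2_indep.
- by move=> *; apply: comparison2_nat.
Qed.
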